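(* Under the Setup and the Conditional asymptotic regime described in the context, for $i,j\in\{0,1\}$, $$\lim_{p\to\infty}E_{S_n}[\hat\varepsilon_i^B\hat\varepsilon_j^B\mid\boldsymbol\mu]=\Phi\!\left((-1)^i\frac{-G_i^B+c}{\sqrt D}\right)\Phi\!\left((-1)^j\frac{-G_j^B+c}{\sqrt D}\right),$$ and consequently $$\lim_{p\to\infty}E_{S_n}[(\hat\varepsilon^B)^2\mid\boldsymbol\mu]=\left[\alpha_0\Phi\!\left(\frac{-G_0^B+c}{\sqrt D}\right)+\alpha_1\Phi\!\left(\frac{G_1^B-c}{\sqrt D}\right)\right]^2,$$ where $G_0^B=\frac{1}{2(1+\gamma_0)}\big(\gamma_0(\bar\eta_{\mathbf m_0,\boldsymbol\mu_1}-\bar\eta_{\mathbf m_0,\boldsymbol\mu_0})+\bar\delta^2_{\boldsymbol\mu}+(1-\gamma_0)J_0+(1+\gamma_0)J_1\big)$, $G_1^B=\frac{-1}{2(1+\gamma_1)}\big(\gamma_1(\bar\eta_{\mathbf m_1,\boldsymbol\mu_0}-\bar\eta_{\mathbf m_1,\boldsymbol\mu_1})+\bar\delta^2_{\boldsymbol\mu}+(1-\gamma_1)J_1+(1+\gamma_1)J_0\big)$, and $D=\bar\delta^2_{\boldsymbol\mu}+J_0+J_1$.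
   Context: Setup. Fix $\alpha_0\in(0,1)$, $\alpha_1=1-\alpha_0$, and $c=\log\frac{1-\alpha_0}{\alpha_0}$. $\Phi$ is the standard normal CDF. For each dimension $p$ there is a known symmetric positive definite $p\times p$ matrix $\Sigma$, class means $\boldsymbol\mu_0,\boldsymbol\mu_1\in\mathbb R^p$, sample sizes $n_0,n_1$, prior means $\mathbf m_0,\mathbf m_1\in\mathbb R^p$ and prior certainty parameters $\nu_0,\nu_1>0$ (all depending on $p$; the index $p$ is suppressed). Class $i$ has distribution $\Pi_i=N(\boldsymbol\mu_i,\Sigma)$. The sample $S_n$ consists of $n_0$ i.i.d. points from $\Pi_0$ and, independently, $n_1$ i.i.d. points from $\Pi_1$; $\bar{\mathbf x}_0,\bar{\mathbf x}_1$ are the class sample means. The LDA classifier assigns $\mathbf x$ to class 1 if $W(\mathbf x)\le c$ and to class 0 otherwise, where $W(\mathbf x)=(\mathbf x-\frac{\bar{\mathbf x}_0+\bar{\mathbf x}_1}{2})^T\Sigma^{-1}(\bar{\mathbf x}_0-\bar{\mathbf x}_1)$. Let $\hat\delta^2=(\bar{\mathbf x}_0-\bar{\mathbf x}_1)^T\Sigma^{-1}(\bar{\mathbf x}_0-\bar{\mathbf x}_1)$. The true error is $\varepsilon=\alpha_0\varepsilon_0+\alpha_1\varepsilon_1$ with $\varepsilon_i=\Phi\Big(\frac{(-1)^{i+1}(\boldsymbol\mu_i-\frac{\bar{\mathbf x}_0+\bar{\mathbf x}_1}{2})^T\Sigma^{-1}(\bar{\mathbf x}_0-\bar{\mathbf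 x}_1)+(-1)^i c}{\hat\delta}\Big)$. The Bayesian MMSE error estimator (for the prior $\boldsymbol\mu_i\sim N(\mathbf m_i,\Sigma/\nu_i)$, $i=0,1$, independent) is $\hat\varepsilon^B=\alpha_0\hat\varepsilon^B_0+\alpha_1\hat\varepsilon^B_1$ with $\hat\varepsilon_i^B=\Phi\Big((-1)^i\frac{-(\mathbf m_i^*-\frac{\bar{\mathbf x}_0+\bar{\mathbf x}_1}{2})^T\Sigma^{-1}(\bar{\mathbf x}_0-\bar{\mathbf x}_1)+c}{\hat\delta}\sqrt{\frac{\nu_i^*}{\nu_i^*+1}}\Big)$, where $\mathbf m_i^*=\frac{n_i\bar{\mathbf x}_i+\nu_i\mathbf m_i}{n_i+\nu_i}$ and $\nu_i^*=n_i+\nu_i$. Notation: $\eta_{\mathbf a,\mathbf b}=(\mathbf a-\mathbf b)^T\Sigma^{-1}(\mathbf a-\mathbf b)$, $\delta^2_{\boldsymbol\mu}=\eta_{\boldsymbol\mu_0,\boldsymbol\mu_1}$; a bar denotes the limit as $p\to\infty$ of the corresponding quantity. Conditional asymptotic regime. $\boldsymbol\mu_0,\boldsymbol\mu_1$ are deterministic for each $p$, and expectations $E_{S_n}[\cdot\mid\boldsymbol\mu]$ are over the sample only. As $p\to\infty$: $n_0,n_1,\nu_0,\nu_1\to\infty$, $p/n_i\to J_i\in[0,\infty)$, $\nu_i/n_i\to\gamma_i\in[0,\infty)$, and for all $i,j\in\{0,1\}$ the quantities $\mathbf m_i^T\Sigma^{-1}\boldsymbol\mu_j$, $\mathbf m_i^T\Sigma^{-1}\mathbf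 m_j$, $\boldsymbol\mu_i^T\Sigma^{-1}\boldsymbol\mu_j$ converge to finite limits (so all the $\eta$'s above converge). It is assumed that $D=\bar\delta^2_{\boldsymbol\mu}+J_0+J_1>0$. $\lim_{p\to\infty}$ denotes the limit along this regime. *)

(* Defs.v *)
From HB Require Import structures.
From mathcomp Require Import all_boot all_order all_algebra.
From mathcomp Require Import all_classical all_reals all_analysis.
Set Implicit Arguments. Unset Strict Implicit. Unset Printing Implicit Defensive.
Import Order.TTheory GRing.Theory Num.Theory.
Local Open Scope classical_set_scope.
Local Open Scope ring_scope.

Section defs.
Variable R : realType.

Definition Phi (x : R) : R := fine (normal_prob (0:R) 1 `]-oo, x]).

Definition spd (p : nat) (S : 'M[R]_p) : Prop :=
  S^T = S /\ forall v : 'cV[R]_p, v != 0 -> 0 < (v^T *m S *m v) ord0 ord0.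

Definition bilS (p : nat) (S : 'M[R]_p) (a b : 'cV[R]_p) : R :=
  (a^T *m invmx S *m b) ord0 ord0.
Definition etaS (p : nat) (S : 'M[R]_p) (a b : 'cV[R]_p) : R := bilS S (a - b) (a - b).

(* a real random variable Y has law N(m, s^2) (s = standard deviation) *)
Definition has_normal_law d (T : measurableType d) (P : probability T R)
  (Y : T -> R) (m s : R) : Prop :=
  measurable_fun setT Y /\
  forall B : set R, measurable B -> P (Y @^-1` B) = normal_prob m s B.

Definition gaussian_vec d (T : measurableType d) (P : probability T R)
  (p : nat) (X : T -> 'cV[R]_p) (mu : 'cV[R]_p) (S : 'M[R]_p) : Prop :=
  forall a : 'cV[R]_p, a != 0 ->
    has_normal_law P (fun w => (a^T *m X w) ord0 ord0) ((a^T *m mu) ord0 ord0)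
      (Num.sqrt ((a^T *m S *m a) ord0 ord0)).

Definition gen_events d (T : measurableType d) (p : nat) (X : T -> 'cV[R]_p)
  : set (set T) :=
  <<s [set E | exists (i : 'I_p) (B : set R), measurable B /\
                 E = (fun w => X w i ord0) @^-1` B] >>.

Definition mutually_independent d (T : measurableType d) (P : probability T R)
  (I : eqType) (dom : I -> Prop) (p : nat) (X : I -> T -> 'cV[R]_p) : Prop :=
  forall (s : seq I) (E : I -> set T), uniq s ->
    (forall k, k \in s -> dom k /\ gen_events (X k) (E k)) ->
    P (\bigcap_(k in [set` s]) E k) = (\prod_(k <- s) P (E k))%E.

Definition smean (T : Type) (p n : nat) (X : nat -> T -> 'cV[R]_p) (w : T)
  : 'cV[R]_p := (n%:R)^-1 *: \sum_(k < n) X k w.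

Definition epsB (p : nat) (S : 'M[R]_p) (alpha0 : R) (n0 n1 : nat)
  (nu0 nu1 : R) (m0 m1 : 'cV[R]_p) (xb0 xb1 : 'cV[R]_p) (i : bool) : R :=
  let c := ln ((1 - alpha0) / alpha0) in
  let n_i := (if i then n1 else n0)%:R in
  let nu_i := if i then nu1 else nu0 in
  let m_i := if i then m1 else m0 in
  let xb_i := if i then xb1 else xb0 in
  let mstar := (n_i + nu_i)^-1 *: (n_i *: xb_i + nu_i *: m_i) in
  let nustar := n_i + nu_i in
  let deltahat := Num.sqrt (bilS S (xb0 - xb1) (xb0 - xb1)) in
  Phi ((-1) ^+ i *
       ((- bilS S (mstar - 2^-1 *: (xb0 + xb1)) (xb0 - xb1) + c) / deltahat *
        Num.sqrt (nustar / (nustar + 1)))).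

End defs.

(* Main.v *)
(* The quadratic form of an average of Gaussian vectors concentrates because its
   mean and variance only involve moments of order at most four of linear forms.
   A linear form u^T W in W = a0 (xbar0 - mu0) + a1 (xbar1 - mu1) is a sum of
   independent centred normal variables, so its first four moments are those of
   N(0, tau u^T S u) with tau = a0^2/n0 + a1^2/n1.  Writing W^T S^-1 W as a sum
   of p squares of such forms, orthonormal for S, gives
   E (W^T S^-1 W - p tau)^2 = 2 p tau^2 -> 0 and p tau -> a0^2 J0 + a1^2 J1, while
   E (b^T S^-1 W)^2 = tau b^T S^-1 b -> 0.  The cases (a0, a1) = (1, 0), (0, 1),
   (1, -1) determine the limits in probability of all inner products in the
   estimator, and the theorem follows by continuity of Phi and boundedness. *)

Require Import Defs.
From HB Require Import structures.
From mathcomp Require Import all_boot all_order all_algebra.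
From mathcomp Require Import all_classical all_reals all_analysis.
From mathcomp Require Import measurable_realfun ring lra.
Import Order.TTheory GRing.Theory Num.Theory numFieldNormedType.Exports.
Local Open Scope classical_set_scope.
Local Open Scope ring_scope.

Set Implicit Arguments.
Unset Strict Implicit.
Unset Printing Implicit Defensive.

(** * Moments of the normal distribution *)

(** Normality is available only for one linear form at a time, and independence only as a
    factorization over generated events, so the joint law of the sample means is never formed.
    Instead, four moments are carried through independent sums, which preserve the Gaussian relation
    between second and fourth moments. The probability spaces change with p. Convergence in
    probability is therefore encoded as convergence along a filter on the pairs (p, w), so that the
    usual rules for sums, products and continuous functions apply directly to random variables. A
    set belongs to this filter when it contains measurable events of large probability, so it need
    not be measurable itself. The limits are constants, hence products of estimators converge in
    probability to products of constants; values in [0, 1] turn this into convergence of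
    expectations. *)

Section NormalMoments.
Variable R : realType.
Notation mu := (@lebesgue_measure R).
Implicit Types (m s x : R).

Lemma normr_expn_le (y : R) k : `|y| ^+ k <= 1 + (y ^+ 2) ^+ k.
Proof.
rewrite -normrX -exprM mulnC exprM normrX.
have : 0 <= `|y| ^+ k by rewrite exprn_ge0.
rewrite (_ : (y ^+ k) ^+ 2 = (`|y| ^+ k) ^+ 2); last by rewrite -normrX real_normK// num_real.
by move: (`|y| ^+ k) => t t0; nra.
Qed.

(** The exponent y^2 / (2 s^2) is split into two halves y^2 / a with a = 4 s^2. One half is the
    exponent for standard deviation sqrt 2 * s; the other absorbs the power of |y|, because exp t >=
    t^k / k!. The summand 1 in the constant comes from bounding |y|^k by 1 + y^(2k). *)
Lemma gauss_tail (k : nat) m s : s != 0 ->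
  exists2 C, 0 <= C & forall x,
    `|x - m| ^+ k * normal_fun m s x <= C * normal_fun m (Num.sqrt 2 * s) x.
Proof.
move=> s0.
have s2 : 0 < s ^+ 2 by rewrite exprn_even_gt0.
pose a := s ^+ 2 *+ 4.
have a0 : 0 < a by rewrite pmulrn_lgt0.
exists (1 + k`!%:R * a ^+ k).
  by rewrite addr_ge0// mulr_ge0// exprn_ge0// ltW.
move=> x; rewrite /normal_fun; set y := x - m.
have -> : - y ^+ 2 / (s ^+ 2 *+ 2) = - (y ^+ 2 / a) + - (y ^+ 2 / a).
  by rewrite /a; field; rewrite s0.
have -> : - y ^+ 2 / ((Num.sqrt 2 * s) ^+ 2 *+ 2) = - (y ^+ 2 / a).
  by rewrite exprMn sqr_sqrtr// /a; field; rewrite s0.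
rewrite expRD mulrA ler_wpM2r ?expR_ge0//.
have b0 : 0 <= y ^+ 2 / a by rewrite divr_ge0 ?sqr_ge0// ltW.
rewrite expRN ler_pdivrMr ?expR_gt0//.
apply: (le_trans (normr_expn_le _ _)).
have e1 : 1 <= expR (y ^+ 2 / a) by rewrite -expR0 ler_expR.
have e2 : (y ^+ 2) ^+ k <= k`!%:R * a ^+ k * expR (y ^+ 2 / a).
  case: k => [|k]; first by rewrite !expr0 fact0 !mul1r.
  have ak : 0 < a ^+ k.+1 by rewrite exprn_gt0.
  have := expR_ge1Dxn k b0; rewrite expr_div_n => h.
  have : (y ^+ 2) ^+ k.+1 / a ^+ k.+1 / (k.+1)`!%:R <= expR (y ^+ 2 / a).
    by apply: le_trans h; rewrite lerDr.
  rewrite ler_pdivrMr ?ltr0n ?fact_gt0// ler_pdivrMr// => /le_trans; apply.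
  by rewrite le_eqVlt; apply/orP; left; apply/eqP; ring.
by rewrite mulrDl mul1r lerD.
Qed.

(** Domination by a multiple of another normal density serves twice: the density is integrable, so
    all centred moments exist, and it is bounded, so boundary terms can be made to vanish. *)
Lemma pow_normal_le (k : nat) m s : s != 0 ->
  exists2 C, 0 <= C & forall x,
    `|(x - m) ^+ k * normal_pdf m s x| <= C * normal_pdf m (Num.sqrt 2 * s) x.
Proof.
move=> s0; have [C C0 h] := gauss_tail k m s0.
have q0 : Num.sqrt 2 * s != 0 by rewrite mulf_neq0// gt_eqF// sqrtr_gt0.
exists (C * normal_peak s / normal_peak (Num.sqrt 2 * s)).
  by rewrite divr_ge0 ?mulr_ge0 ?normal_peak_ge0.
move=> x; rewrite !normal_pdfE//= normrM normrX [X in _ * X]ger0_norm; last first.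
  by rewrite mulr_ge0 ?normal_peak_ge0 ?normal_fun_ge0.
have pq : normal_peak (Num.sqrt 2 * s) != 0 by rewrite gt_eqF// normal_peak_gt0.
rewrite mulrCA [X in _ <= X](_ : _ =
  normal_peak s * (C * normal_fun m (Num.sqrt 2 * s) x)); last by field.
by rewrite ler_wpM2l ?normal_peak_ge0.
Qed.

Lemma integrable_pow_normal (k : nat) m s : s != 0 ->
  mu.-integrable setT (fun x => ((x - m) ^+ k * normal_pdf m s x)%:E).
Proof.
move=> s0; have [C C0 h] := pow_normal_le k m s0.
have := integrable_normal_pdf m (Num.sqrt 2 * s).
move=> /(integrableZl measurableT C) i1.
apply: (le_integrable measurableT _ _ i1).
  apply/measurable_EFinP; apply: measurable_funM; last exact: measurable_normal_pdf.
  by apply: measurable_funX; apply: measurable_funB.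
move=> x _; rewrite /= lee_fin (le_trans (h x))//.
by rewrite ler_norm.
Qed.

Lemma is_derive_normal_pdf m s x : s != 0 ->
  is_derive x 1 (normal_pdf m s) (- (x - m) / s ^+ 2 * normal_pdf m s x).
Proof.
move=> s0; rewrite normal_pdfE//.
have hs : is_derive x (1 : R) (fun x => (- (2 * s ^+ 2)^-1) *: ((x - m) ^+ 2))
    (- (x - m) / s ^+ 2).
  by apply: is_derive_eq; rewrite /GRing.scale/=; field; rewrite s0.
have he := @is_derive1_comp R expR _ x _ _ (is_derive_expR _) hs.
have := @is_deriveZ R _ _ _ (normal_peak s) x 1 _ he.
congr is_derive; rewrite /normal_fun /GRing.scale/=.
  apply/funext => y /=; congr (_ * expR _).
  by rewrite /GRing.scale/=; field; rewrite s0.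
have -> : - (2 * s ^+ 2)^-1 * (x - m) ^+ 2 = - (x - m) ^+ 2 / (s ^+ 2 *+ 2).
  by field; rewrite s0.
by ring.
Qed.

Lemma is_derive_pow_normal (k : nat) m s x : s != 0 ->
  is_derive x 1 (fun x => (x - m) ^+ k * normal_pdf m s x)
   (k%:R * (x - m) ^+ k.-1 * normal_pdf m s x
     - (x - m) ^+ k.+1 * normal_pdf m s x / s ^+ 2).
Proof.
move=> s0; have hd := is_derive_normal_pdf m x s0.
have hp : is_derive x (1 : R) (fun x => (x - m) ^+ k) (k%:R * (x - m) ^+ k.-1).
  have h1 : is_derive x (1 : R) (fun x => x - m) 1 by apply: is_derive_eq; rewrite subr0.
  have := @is_deriveX _ _ (fun x => x - m) k x 1 _ h1.
  by rewrite /GRing.scale/= mulr1 exprfctE.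
have := is_deriveM hp hd.
congr is_derive; rewrite /GRing.scale/=.
by rewrite (exprS (x - m)); field; rewrite s0.
Qed.

(** The integrand is the derivative of (x - m)^k times the density, which vanishes at both ends of
    the line. This yields the recursion between the moments of orders k + 1 and k - 1. For k = 0 the
    truncated [k.-1] is harmless, its coefficient being 0. *)
Lemma integral_stein_normal (k : nat) m s : s != 0 ->
  (\int[mu]_x (k%:R * (x - m) ^+ k.-1 * normal_pdf m s x
     - (x - m) ^+ k.+1 * normal_pdf m s x / s ^+ 2)%:E = 0)%E.
Proof.
move=> s0.
pose F x := (x - m) ^+ k * normal_pdf m s x.
pose f x := k%:R * (x - m) ^+ k.-1 * normal_pdf m s x
     - (x - m) ^+ k.+1 * normal_pdf m s x / s ^+ 2.
rewrite -[LHS]/(\int[mu]_x (f x)%:E)%E.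
have dF x : is_derive x 1 F (f x) by exact: is_derive_pow_normal.
have intf : mu.-integrable setT (EFin \o f).
  rewrite (_ : _ \o _ = (fun x => k%:R%:E * ((x - m) ^+ k.-1 * normal_pdf m s x)%:E
     - (s ^+ 2)^-1%:E * ((x - m) ^+ k.+1 * normal_pdf m s x)%:E)%E); last first.
    by apply/funext => x /=; rewrite /f -!EFinM -EFinB; congr EFin; ring.
  by apply: integrableB => //; apply: integrableZl => //; exact: integrable_pow_normal.
have cF : continuous F.
  move=> x; apply: differentiable_continuous; apply/derivable1_diffP.
  by have [] := dF x.
have cf : continuous f.
  have cp n : continuous (fun x : R => (x - m) ^+ n).
    move=> x; apply: (@cvg_comp _ _ _ (fun x => x - m) (fun y => y ^+ n)).
      by apply: cvgB; [exact: cvg_id | exact: cvg_cst].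
    exact: exprn_continuous.
  have cn := @continuous_normal_pdf R m s s0.
  move=> x; rewrite /continuous_at /f; apply: cvgB; apply: cvgM; try exact: cvg_cst; try exact: cn.
    by apply: cvgM; [exact: cvg_cst | exact: cp].
  by apply: cvgM; [exact: cp | exact: cn].
pose I n := `[m - n.+1%:R, m + n.+1%:R]%classic : set R.
have FTC n : (\int[mu]_(x in I n) (f x)%:E = (F (m + n.+1%:R) - F (m - n.+1%:R))%:E)%E.
  rewrite EFinB (@continuous_FTC2 R f F)//.
  - by rewrite ltrD2l gtrN// ltr0n.
  - exact: continuous_subspaceT.
  - split.
    + by move=> x _; have [] := dF x.
    + by apply: cvg_at_right_filter; exact: cF.
    + by apply: cvg_at_left_filter; exact: cF.
  - by move=> x _; rewrite derive1E; apply/derive_val.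
(* Bounding the power k + 1 instead of k gains a factor 1 / (n + 1) at the end points of [I n],
   where |x - m| = n + 1. *)
have [C C0 hC] := pow_normal_le k.+1 m s0.
have cv0 : (fun n => \int[mu]_(x in I n) (f x)%:E)%E @ \oo --> 0%E.
  have q0 : Num.sqrt 2 * s != 0 by rewrite mulf_neq0// gt_eqF// sqrtr_gt0.
  pose K := C * normal_peak (Num.sqrt 2 * s).
  have hK x (n : nat) : `|x - m| = n.+1%:R -> `|F x| <= K / n.+1%:R.
    move=> xn; rewrite ler_pdivlMr ?ltr0n// -xn -normrM mulrC mulrA -exprS.
    by apply: (le_trans (hC x)); rewrite ler_wpM2l// normal_pdf_ub.
  rewrite (_ : (fun n => _) = EFin \o (fun n => F (m + n.+1%:R) - F (m - n.+1%:R))).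
    apply: cvg_EFin; first exact: nearW.
    apply/norm_cvg0P.
    apply: (@squeeze_cvgr _ _ _ _ (cst 0) (fun n => (2 * K) * n.+1%:R^-1)).
    - apply: nearW => n /=; rewrite normr_ge0/= (le_trans (ler_normB _ _))//.
      rewrite -mulrA mulr_natl mulr2n lerD// hK//.
        by rewrite addrC addKr normr_nat.
      by rewrite addrC addKr normrN normr_nat.
    - exact: cvg_cst.
    - rewrite -[X in _ --> X](mulr0 (2 * K)); apply: cvgM; first exact: cvg_cst.
      exact: cvg_harmonic.
  by apply/funext => n; rewrite FTC.
(* The truncations of [f] to the growing intervals converge pointwise and are dominated by |f|. *)
have cvf : (fun n => \int[mu]_(x in I n) (f x)%:E)%E @ \oo --> (\int[mu]_x (f x)%:E)%E.
  under eq_fun do rewrite integral_mkcond.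
  have [] := @dominated_convergence _ _ _ mu setT measurableT
    (fun n => (EFin \o f) \_ (I n)) (EFin \o f) (fun x => `|(f x)%:E|)%E.
  - move=> n; apply/(measurable_restrictT (EFin \o f)).
      exact: measurable_itv.
    by apply: measurable_funTS; exact: (measurable_int mu intf).
  - exact: (measurable_int mu intf).
  - apply: aeW => x _; apply: cvg_near_cst.
    near=> n; rewrite patchE mem_set// /I/= in_itv/= -ler_distlC distrC.
    apply: (@le_trans _ _ n%:R); last by rewrite ler_nat.
    near: n; exact: nbhs_infty_ger.
  - exact: integrable_abse.
  - apply: aeW => x n _; rewrite patchE; case: ifP => _ //=.
    by rewrite lee_fin normr0.
  - by move=> _ _.
exact: (cvg_unique _ cvf cv0).
Unshelve. all: by end_near.
Qed.

End NormalMoments.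

(** * Expectations, and transfer of integrals to the law of a variable *)

Section Mean.
Variable R : realType.
Notation mu := (@lebesgue_measure R).

(** The change of variables goes through the Radon-Nikodym derivative of [normal_prob], which equals
    the density almost everywhere because both have the same integral over every measurable set. *)
Lemma ge0_integral_normal_prob (m s : R) (f : R -> \bar R) :
  (forall x, 0 <= f x)%E -> measurable_fun setT f ->
  (\int[normal_prob m s]_x f x = \int[mu]_x (f x * (normal_pdf m s x)%:E))%E.
Proof.
move=> f0 mf.
have dom := normal_prob_dominates m s.
rewrite -(Radon_Nikodym_SigmaFinite.change_of_variables dom f0 measurableT mf).
apply: ae_eq_integral => //.
- apply: emeasurable_funM => //.
  apply: measurable_int; exact: Radon_Nikodym_SigmaFinite.f_integrable.
- apply: emeasurable_funM => //; apply/measurable_EFinP; exact: measurable_normal_pdf.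
- apply: ae_eqe_mul2l => /=.
  apply: integral_ae_eq => //.
  + exact: Radon_Nikodym_SigmaFinite.f_integrable.
  + apply/measurable_EFinP; exact: measurable_normal_pdf.
  + by move=> E _ mE; rewrite -Radon_Nikodym_SigmaFinite.f_integral.
Qed.

(** Integrability is bundled with the value so that expectations can be added and multiplied without
    separate side conditions. *)
Definition has_mean d (T : measurableType d) (P : probability T R) (X : T -> R) (e : R) :=
  P.-integrable setT (EFin \o X) /\ (\int[P]_w (X w)%:E = e%:E)%E.

Lemma ge0_integral_normal_law d (T : measurableType d) (P : probability T R)
    (Y : T -> R) (m s : R) (f : R -> \bar R) :
  has_normal_law P Y m s -> (forall x, 0 <= f x)%E -> measurable_fun setT f ->
  (\int[P]_w f (Y w) = \int[mu]_x (f x * (normal_pdf m s x)%:E))%E.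
Proof.
move=> [mY hY] f0 mf; rewrite -ge0_integral_normal_prob//.
have mY' : measurable_fun setT (Y : T -> measurableTypeR R) by exact: mY.
pose Y' : {RV P >-> measurableTypeR R} := @mfun_Sub _ _ _ (measurableTypeR R) Y (mem_set mY').
rewrite -[LHS](ge0_integral_distribution Y' mf f0).
by apply: eq_measure_integral => A mA _; exact: hY.
Qed.

(** The nonnegative case is applied to |g| for integrability, then to the positive and negative
    parts of g. Multiplication by the density commutes with taking these parts because the density
    is nonnegative. *)
Lemma has_mean_normal_law d (T : measurableType d) (P : probability T R)
    (Y : T -> R) (m s e : R) (g : R -> R) :
  has_normal_law P Y m s -> measurable_fun setT g ->
  mu.-integrable setT (fun x => (g x * normal_pdf m s x)%:E) ->
  (\int[mu]_x (g x * normal_pdf m s x)%:E = e%:E)%E ->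
  has_mean P (g \o Y) e.
Proof.
move=> hY mg ig ge.
have mgY : measurable_fun setT (g \o Y) by apply: measurableT_comp => //; case: hY.
have iY : P.-integrable setT (EFin \o (g \o Y)).
  apply/integrableP; split; first exact/measurable_EFinP.
  rewrite (ge0_integral_normal_law hY (f := fun x => `|(g x)%:E|%E))//; last first.
    by apply: measurableT_comp => //; exact/measurable_EFinP.
  move/integrableP: ig => [_]; congr (_ < _)%E; apply: eq_integral => x _ /=.
  by rewrite normrM EFinM (ger0_norm (normal_pdf_ge0 _ _ _)).
split => //; rewrite -ge.
rewrite (integralE _ _ (fun w => ((g \o Y) w)%:E)) [RHS]integralE.
have mEg : measurable_fun setT (EFin \o g) by exact/measurable_EFinP.
congr (_ - _)%E.
  have /(ge0_integral_normal_law hY) h : forall x, (0 <= (EFin \o g)^\+ x)%E by [].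
  transitivity (\int[P]_w ((EFin \o g)^\+ (Y w)))%E.
  by apply: eq_integral => w _; rewrite !funeposE.
rewrite h; last exact: measurable_funepos.
  apply: eq_integral => x _; rewrite !funeposE /= -EFin_max -EFinM -EFin_max.
  by rewrite maxr_pMl ?normal_pdf_ge0// mul0r.
have /(ge0_integral_normal_law hY) h : forall x, (0 <= (EFin \o g)^\- x)%E by [].
transitivity (\int[P]_w ((EFin \o g)^\- (Y w)))%E.
  by apply: eq_integral => w _; rewrite !funenegE.
rewrite h; last exact: measurable_funeneg.
apply: eq_integral => x _; rewrite !funenegE /= -EFin_max -EFinM -EFin_max.
by rewrite maxr_pMl ?normal_pdf_ge0// mul0r mulNr.
Qed.

Section HasMean.
Context d (T : measurableType d) (P : probability T R).
Implicit Types (X Y : T -> R).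

Lemma has_mean_measurable X a : has_mean P X a -> measurable_fun setT X.
Proof. by case=> /(measurable_int P) /measurable_EFinP. Qed.

Lemma has_meanD X Y a b : has_mean P X a -> has_mean P Y b ->
  has_mean P (fun w => X w + Y w) (a + b).
Proof.
move=> [iX eX] [iY eY]; split; first exact: (integrableD measurableT iX iY).
by under eq_integral do rewrite EFinD; rewrite integralD// eX eY.
Qed.

Lemma has_meanZ c X a : has_mean P X a -> has_mean P (fun w => c * X w) (c * a).
Proof.
move=> [iX eX]; split; first exact: (integrableZl measurableT c iX).
by under eq_integral do rewrite EFinM; rewrite integralZl// eX.
Qed.

Lemma has_mean_cst c : has_mean P (fun _ => c) c.
Proof.
split; first exact: finite_measure_integrable_cst.
have h := @integral_cst _ _ _ P setT measurableT c%:E.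
by rewrite [LHS]h /= probability_setT mule1.
Qed.

Lemma has_mean_sum (I : Type) (r : seq I) (X : I -> T -> R) a :
  (forall i, has_mean P (X i) (a i)) ->
  has_mean P (fun w => \sum_(i <- r) X i w) (\sum_(i <- r) a i).
Proof.
move=> h; elim: r => [|i r ih].
  rewrite big_nil (_ : (fun _ => _) = fun=> 0); first exact: has_mean_cst.
  by apply/funext => w; rewrite big_nil.
rewrite big_cons (_ : (fun _ => _) = fun w => X i w + \sum_(i <- r) X i w).
  exact: has_meanD.
by apply/funext => w; rewrite big_cons.
Qed.

End HasMean.
End Mean.

(** * Independence *)

Section Independence.
Context {R : realType} d (T : measurableType d) (P : probability T R).
Implicit Types X Y : T -> R.

Definition indep2 X Y := forall A B : set R, measurable A -> measurable B ->
  P (X @^-1` A `&` Y @^-1` B) = (P (X @^-1` A) * P (Y @^-1` B))%E.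

Lemma measurable_preimage X (A : set R) :
  measurable_fun setT X -> measurable A -> measurable (X @^-1` A).
Proof. by move=> mX mA; rewrite -[_ @^-1` _]setTI; exact: mX. Qed.

(** Independence from E passes from rectangles to all Borel sets of the plane. It is meant for sets
    such as {z | z.1 + z.2 in B}, which are not rectangles. *)
Lemma indep_pair_event X Y (E : set T) :
  measurable_fun setT X -> measurable_fun setT Y -> measurable E ->
  (forall A B : set R, measurable A -> measurable B ->
    P ((X @^-1` A `&` Y @^-1` B) `&` E) = (P (X @^-1` A `&` Y @^-1` B) * P E)%E) ->
  forall C : set (R * R), measurable C ->
    P ((fun w => (X w, Y w)) @^-1` C `&` E) =
    (P ((fun w => (X w, Y w)) @^-1` C) * P E)%E.
Proof.
move=> mX mY mE hE C mC.
have mXY : measurable_fun setT (fun w => (X w, Y w)) by exact: measurable_fun_pair.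
pose XY : {mfun T >-> (R * R)%type} := mfun_Sub (mem_set mXY).
have PE0 : 0 <= fine (P E) by rewrite fine_ge0.
pose r : {nonneg R} := NngNum PE0.
pose m1 : {measure set (R * R) -> \bar R} := pushforward (mrestr P mE) XY.
pose m2 : {measure set (R * R) -> \bar R} := mscale r (distribution P XY).
(* Both sides are finite measures in C, and they agree on rectangles. *)
suff : m1 mXY C = m2 C.
  rewrite /m1 /m2 /= /pushforward /mrestr /mscale/= /distribution /pushforward/= => ->.
  by rewrite muleC fineK// fin_num_measure.
pose G : set (set (R * R)) :=
  [set C | exists A, measurable A /\ exists B, measurable B /\ C = A `*` B].
apply: (measure_unique G (fun=> setT)) => //.
- rewrite measurable_prod_measurableType //; congr (<<s _ >>).
  rewrite predeqE; split => [[A mA [B mB <-]]|[A [mA [B [mB ->]]]]].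
    by exists A; split => //; exists B.
  by exists A => //; exists B.
- move=> /= _ _ [X1 [mX1 [X2 [mX2 ->]]]] [Y1 [mY1 [Y2 [mY2 ->]]]].
  rewrite -setXI; exists (X1 `&` Y1); split; first exact: measurableI.
  by exists (X2 `&` Y2); split => //; exact: measurableI.
- by move=> _; exists setT; split => //; exists setT; split => //; rewrite setXTT.
- by rewrite bigcup_const.
- move=> _ [A [mA [B [mB ->]]]].
  rewrite /m1 /m2 /= /pushforward /mrestr /mscale/= /distribution /pushforward/=.
  rewrite fineK ?fin_num_measure// muleC.
  exact: hE.
- move=> _; rewrite /m1 /= /pushforward /mrestr /=.
  apply: le_lt_trans (ltry 1).
  by rewrite preimage_setT setTI; exact: probability_le1.
Qed.

Lemma indep2_distribution X Y (mX : measurable_fun setT X) (mY : measurable_fun setT Y)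
    (mXY : measurable_fun setT (fun w => (X w, Y w))) :
  indep2 X Y -> forall C : set (R * R), measurable C ->
  (distribution P (mfun_Sub (mem_set mX)) \x distribution P (mfun_Sub (mem_set mY)))%E C =
  distribution P (mfun_Sub (mem_set mXY)) C.
Proof.
by move=> h; apply: product_measure_unique => A B mA mB; exact: h.
Qed.

(** Under independence the joint law is the product of the two laws, so Tonelli gives integrability
    of the product and Fubini its integral. *)
Lemma has_meanM X Y a b : indep2 X Y -> has_mean P X a -> has_mean P Y b ->
  has_mean P (fun w => X w * Y w) (a * b).
Proof.
move=> h hX hY.
have mX := has_mean_measurable hX; have mY := has_mean_measurable hY.
have mXY : measurable_fun setT (fun w => (X w, Y w)) by exact: measurable_fun_pair.
have hd := indep2_distribution mX mY mXY h.
set pX := distribution P _ in hd; set pY := distribution P (mfun_Sub (mem_set mY)) in hd.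
set pXY := distribution P _ in hd.
have [iX eX] := hX; have [iY eY] := hY.
have iXd : pX.-integrable setT (EFin : R -> \bar R).
  by apply: integrable_pushforward => //; exact: mX.
have iYd : pY.-integrable setT (EFin : R -> \bar R).
  by apply: integrable_pushforward => //; exact: mY.
have eXd : (\int[pX]_x x%:E = a%:E)%E.
  by rewrite -eX; apply: integral_distribution.
have eYd : (\int[pY]_x x%:E = b%:E)%E.
  by rewrite -eY; apply: integral_distribution.
pose f (z : R * R) := (z.1 * z.2)%:E.
have mf : measurable_fun setT f.
  by apply/measurable_EFinP; apply: measurable_funM.
have if_ : (pX \x pY)%E.-integrable setT f.
  apply/(integrable12ltyP _ _ mf).
  have iYa := integrable_abse iYd.
  have h1 x : (\int[pY]_y `|f (x, y)| = \int[pY]_y `|y%:E| * `|x%:E|)%E.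
    under eq_integral do rewrite /f /= normrM EFinM muleC.
    by rewrite (integralZr measurableT iYa).
  under eq_integral do rewrite h1.
  have fY := integrable_fin_num measurableT iYa.
  rewrite -(fineK fY) (integralZl measurableT (integrable_abse iXd)).
  by rewrite ltey_eq fin_numM// (integrable_fin_num measurableT (integrable_abse iXd)).
have eXY g : (\int[pXY]_z g z = \int[(pX \x pY)%E]_z g z)%E.
  by apply: eq_measure_integral => A mA _; exact/esym/hd.
have mg : measurable_fun setT (fun w => X w * Y w) by exact: measurable_funM.
have iXY : P.-integrable setT (EFin \o (fun w => X w * Y w)).
  apply/integrableP; split; first exact/measurable_EFinP.
  move/integrableP: if_ => [_]; rewrite -eXY.
  by rewrite ge0_integral_distribution//; exact: measurableT_comp.
split => //.
rewrite -(integral_distribution (X := mfun_Sub (mem_set mXY)) mf iXY) [LHS]eXY.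
rewrite -(integral12_prod_meas1 if_) /fubini_F /f /=.
under eq_integral do under eq_integral do rewrite EFinM.
under eq_integral do rewrite (integralZl measurableT iYd) eYd.
by rewrite (integralZr measurableT iXd) eXd.
Qed.

(* 0, v, 0 and 3 v^2 are the first four moments of N(0, v). *)
Definition gaussian_moments X v :=
  [/\ has_mean P X 0, has_mean P (fun w => X w ^+ 2) v,
      has_mean P (fun w => X w ^+ 3) 0 &
      has_mean P (fun w => X w ^+ 4) (3 * v ^+ 2)].

Lemma gaussian_moments_measurable X v : gaussian_moments X v -> measurable_fun setT X.
Proof. by case=> /has_mean_measurable. Qed.

Lemma has_mean_eq X Y a b : X =1 Y -> a = b -> has_mean P X a -> has_mean P Y b.
Proof. by move=> /funext -> ->. Qed.

(** Stein's recursion M(k+1) = s^2 k M(k-1), started from the total mass M(0) = 1 and used for k =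
    0, 1, 2, 3. *)
Lemma gaussian_moments_normal X m s : has_normal_law P X m s -> s != 0 ->
  gaussian_moments (fun w => X w - m) (s ^+ 2).
Proof.
move=> hX s0.
pose M k e := (\int[@lebesgue_measure R]_x ((x - m) ^+ k * normal_pdf m s x)%:E = e%:E)%E.
have hM k e : M k e -> has_mean P (fun w => (X w - m) ^+ k) e.
  move=> hk; apply: (has_mean_normal_law (g := fun x => (x - m) ^+ k) hX) hk.
    by apply: measurable_funX; exact: measurable_funB.
  exact: integrable_pow_normal.
have ip k := integrable_pow_normal k m s0.
have stein k : M k.+1 (s ^+ 2 * (k%:R * fine
    (\int[@lebesgue_measure R]_x ((x - m) ^+ k.-1 * normal_pdf m s x)%:E))).
  have := integral_stein_normal k m s0.
  under eq_integral do rewrite -mulrA [X in _ - X]mulrC EFinB 2!EFinM.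
  rewrite integralB//; [|exact: (integrableZl measurableT _ (ip _))..].
  rewrite (integralZl measurableT (ip k.-1)) (integralZl measurableT (ip k.+1)) /M.
  have := integrable_fin_num measurableT (ip k.-1).
  have := integrable_fin_num measurableT (ip k.+1).
  move=> /fineK <- /fineK <-; rewrite -!EFinM -EFinB => -[] /eqP.
  rewrite subr_eq0 /= => /eqP ->; congr EFin.
  by rewrite mulrA divff ?mul1r// expf_eq0.
have M0 : M 0 1.
  by rewrite /M; under eq_integral do rewrite expr0 mul1r; exact: integral_normal_pdf.
have M1 : M 1 0 by have := stein 0; rewrite mul0r mulr0.
have M2 : M 2 (s ^+ 2) by have := stein 1; rewrite /= M0 /= !mulr1.
have M3 : M 3 0 by have := stein 2; rewrite /= M1 /= !mulr0.
have M4 : M 4 (3 * (s ^+ 2) ^+ 2).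
  by have := stein 3; rewrite /= M2 /=; congr M; ring.
split; by [exact: (hM 1%N) | exact: hM].
Qed.

Lemma indep2_pow X Y k l : measurable_fun setT X -> measurable_fun setT Y -> indep2 X Y ->
  indep2 (fun w => X w ^+ k) (fun w => Y w ^+ l).
Proof.
move=> mX mY h A B mA mB.
have mp n (C : set R) : measurable C -> measurable ((fun x : R => x ^+ n) @^-1` C).
  have mf : measurable_fun setT (fun x : R => x ^+ n) by exact: measurable_funX.
  by move=> mC; rewrite -[X in measurable X]setTI; exact: mf.
exact: (h _ _ (mp k A mA) (mp l B mB)).
Qed.

(** Binomial expansion: the cross terms with an odd power have mean 0, and 3 u^2 + 6 u v + 3 v^2 = 3
    (u + v)^2, so the Gaussian form of the fourth moment is closed under independent sums. *)
Lemma gaussian_momentsD X Y u v : indep2 X Y ->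
  gaussian_moments X u -> gaussian_moments Y v ->
  gaussian_moments (fun w => X w + Y w) (u + v).
Proof.
move=> h hX hY.
have mX := gaussian_moments_measurable hX; have mY := gaussian_moments_measurable hY.
case: hX => X1 X2 X3 X4; case: hY => Y1 Y2 Y3 Y4.
have hp k l := @has_meanM _ _ _ _ (@indep2_pow _ _ k l mX mY h).
split.
- by apply: has_mean_eq (has_meanD X1 Y1); rewrite ?addr0.
- have h11 := hp _ _ 1%N 1%N X1 Y1.
  by apply: has_mean_eq (has_meanD (has_meanD X2 (has_meanZ 2 h11)) Y2) => [w|]; ring.
- have h12 := hp _ _ 1%N 2%N X1 Y2; have h21 := hp _ _ 2%N 1%N X2 Y1.
  apply: has_mean_eq (has_meanD (has_meanD X3 (has_meanZ 3 h21))
    (has_meanD (has_meanZ 3 h12) Y3)) => [w|]; ring.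
- have h13 := hp _ _ 1%N 3%N X1 Y3; have h31 := hp _ _ 3%N 1%N X3 Y1.
  have h22 := hp _ _ 2%N 2%N X2 Y2.
  apply: has_mean_eq (has_meanD (has_meanD X4 (has_meanZ 4 h31))
    (has_meanD (has_meanZ 6 h22) (has_meanD (has_meanZ 4 h13) Y4))) => [w|]; ring.
Qed.

Lemma gaussian_momentsZ c X v : gaussian_moments X v ->
  gaussian_moments (fun w => c * X w) (c ^+ 2 * v).
Proof.
case=> X1 X2 X3 X4; split.
- by apply: has_mean_eq (has_meanZ c X1) => [w|]; ring.
- by apply: has_mean_eq (has_meanZ (c ^+ 2) X2) => [w|]; ring.
- by apply: has_mean_eq (has_meanZ (c ^+ 3) X3) => [w|]; ring.
- by apply: has_mean_eq (has_meanZ (c ^+ 4) X4) => [w|]; ring.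
Qed.

Lemma gaussian_moments0 : gaussian_moments (fun _ => 0) 0.
Proof.
have h := has_mean_cst P (0 : R).
by split; apply: has_mean_eq h => // *; rewrite ?expr0n ?mulr0.
Qed.

End Independence.

(** * Sums of functions of mutually independent vectors *)

Section IndependentSums.
Context {R : realType} d (T : measurableType d) (P : probability T R).
Context (I : eqType) (dom : I -> Prop) (p : nat) (X : I -> T -> 'cV[R]_p).
Hypothesis indX : mutually_independent P dom X.
Hypothesis mX : forall k, dom k -> forall i, measurable_fun setT (fun w => X k w i ord0).

Lemma gen_events_measurable k E : dom k -> gen_events (X k) E -> measurable E.
Proof.
move=> dk; apply: smallest_sub; first exact: sigma_algebra_measurable.
by move=> _ [i [B [mB ->]]]; apply: measurable_preimage => //; exact: mX.
Qed.

(** On the space [T'], which carries exactly the sigma-algebra generated by the coordinates, these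
    coordinates are measurable by construction; an affine combination then inherits measurability
    from the usual closure rules. *)
Lemma gen_events_linear (Y : T -> 'cV[R]_p) (a : 'cV[R]_p) (c r : R) (B : set R) :
  measurable B -> gen_events Y ((fun w => c * ((a^T *m Y w) ord0 ord0 - r)) @^-1` B).
Proof.
move=> mB; rewrite /gen_events; set G := (X in <<s X >>).
pose T' := g_sigma_algebraType G.
have mi i : measurable_fun setT (fun w : T' => Y w i ord0).
  move=> _ C mC; rewrite setTI; apply: sub_sigma_algebra.
  by exists i, C.
have ms : measurable_fun setT (fun w : T' => c * (\sum_i a i ord0 * Y w i ord0 - r)).
  apply: measurable_funM => //; apply: measurable_funB => //.
  apply: measurable_sum => i; exact: measurable_funM.
have := ms measurableT _ mB; rewrite setTI.
congr (<<s G >>); apply/funext => w /=; congr (B (_ * (_ - _))).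
by rewrite mxE; apply: eq_bigr => i _; rewrite mxE.
Qed.

Variables (xi : I -> T -> R).
Hypothesis xiX : forall k, dom k -> forall B : set R, measurable B ->
  gen_events (X k) (xi k @^-1` B).

Lemma measurable_xi k : dom k -> measurable_fun setT (xi k).
Proof.
by move=> dk _ B mB; rewrite setTI; apply: (gen_events_measurable dk); exact: xiX.
Qed.

Lemma measurable_sum_xi (s : seq I) : (forall k, k \in s -> dom k) ->
  measurable_fun setT (fun w => \sum_(k <- s) xi k w).
Proof.
elim: s => [|k s ih] ds.
  by rewrite (_ : (fun _ => _) = fun=> 0)//; apply/funext => w; rewrite big_nil.
rewrite (_ : (fun _ => _) = fun w => xi k w + \sum_(k <- s) xi k w).
  apply: measurable_funD; first by apply: measurable_xi; apply: ds; rewrite mem_head.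
  by apply: ih => l ls; apply: ds; rewrite in_cons ls orbT.
by apply/funext => w; rewrite big_cons.
Qed.

Local Notation sumxi s := (fun w => (\sum_(k <- s) xi k w)%R).

Lemma set_cons (k : I) (t : seq I) : [set` k :: t] = k |` [set` t].
Proof.
apply/seteqP; split=> y /=; rewrite in_cons.
  by case/predU1P => [->|]; [left|right].
by case=> [->|->]; rewrite ?eqxx ?orbT.
Qed.

Lemma measurable_bigcap_seq (t : seq I) (E : I -> set T) :
  (forall k, k \in t -> measurable (E k)) -> measurable (\bigcap_(k in [set` t]) E k).
Proof.
elim: t => [|k t ih] mE.
  by rewrite (_ : [set` _] = set0) ?bigcap_set0//; apply/seteqP; split.
rewrite set_cons bigcap_setU1; apply: measurableI; first by apply: mE; rewrite mem_head.
by apply: ih => l lt; apply: mE; rewrite in_cons lt orbT.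
Qed.

(** Mutual independence speaks of events attached to single indices, whereas a sum mixes several.
    The induction moves one index k at a time from the list of events into the sum: the pair formed
    by [xi k] and the remaining sum is shown independent of the events of t on rectangles, and
    [indep_pair_event] extends this to the half-plane-like set defining the longer sum. *)
Lemma indep_sum_event (s t : seq I) (E : I -> set T) (B : set R) :
  uniq (s ++ t) -> (forall k, k \in s ++ t -> dom k) ->
  (forall k, k \in t -> gen_events (X k) (E k)) -> measurable B ->
  P (sumxi s @^-1` B `&` \bigcap_(k in [set` t]) E k) =
  (P (sumxi s @^-1` B) * P (\bigcap_(k in [set` t]) E k))%E.
Proof.
elim: s t E B => [|k s ih] t E B us ds gE mB.
  have -> : sumxi [::] = cst (0 : R).
    by apply/funext => w; rewrite big_nil.
  rewrite preimage_cst; case: ifP => _; last by rewrite set0I measure0 mul0e.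
  by rewrite setTI probability_setT mul1e.
have us' : uniq (s ++ k :: t) by rewrite -[k :: t]cat1s (perm_uniq (permEl (perm_catCA _ _ _))).
have ds' l : l \in s ++ k :: t -> dom l.
  by rewrite -[k :: t]cat1s (perm_mem (permEl (perm_catCA _ _ _))); exact: ds.
have dk : dom k by apply: ds; rewrite mem_head.
have kt : k \notin t by move: us; rewrite /= mem_cat negb_or -andbA => /and3P[].
have dt l : l \in t -> dom l by move=> lt; apply: ds; rewrite in_cons mem_cat lt !orbT.
have uks : uniq (s ++ [:: k]).
  by move: us'; rewrite -cat_rcons cat_uniq cats1 => /andP[].
have dks l : l \in s ++ [:: k] -> dom l.
  by rewrite mem_cat mem_seq1 => ls; apply: ds'; rewrite mem_cat in_cons; case/orP: ls => ->; rewrite ?orbT.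
pose Ts := sumxi s.
have mTs : measurable_fun setT Ts.
  by apply: measurable_sum_xi => l ls; apply: ds'; rewrite mem_cat ls.
pose E0 := \bigcap_(l in [set` t]) E l.
have mE0 : measurable E0.
  apply: measurable_bigcap_seq => l lt.
  by apply: (gen_events_measurable (dt l lt)); exact: gE.
have hE : forall A B : set R, measurable A -> measurable B ->
    P ((xi k @^-1` A `&` Ts @^-1` B) `&` E0) = (P (xi k @^-1` A `&` Ts @^-1` B) * P E0)%E.
  move=> A C mA mC.
  (* Since k is not in t, overriding the family at k leaves the events of t unchanged. *)
  pose E' l := if l == k then xi k @^-1` A else E l.
  have gE' l : l \in k :: t -> gen_events (X l) (E' l).
    rewrite in_cons /E'; case: eqP => [->|_] /=; [by move=> _; exact: xiX|exact: gE].
  have E'k : E' k = xi k @^-1` A by rewrite /E' eqxx.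
  have E't : \bigcap_(l in [set` t]) E' l = E0.
    apply: eq_bigcapr => l /= lt; rewrite /E'; case: eqP => // lk.
    by rewrite -lk lt in kt.
  (* The induction hypothesis is used twice: here it separates the sum over s from [xi k] and all
     events of t, and in [h2] from [xi k] alone. Comparing the two isolates the factor for t. *)
  have h1 := ih (k :: t) E' C us' ds' gE' mC.
  have gE'k l : l \in [:: k] -> gen_events (X l) (E' l).
    by rewrite mem_seq1 => /eqP ->; apply: gE'; rewrite mem_head.
  have h2 := ih [:: k] E' C uks dks gE'k mC.
  rewrite set_cons bigcap_setU1 E'k E't in h1.
  rewrite set_cons1 bigcap_set1 E'k in h2.
  rewrite (setIC (xi k @^-1` A)) -setIA [LHS]h1 [X in _ = (X * _)%E]h2 -muleA; congr (_ * _)%E.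
  have u1 : uniq (k :: t) by move: us'; rewrite cat_uniq => /and3P[].
  have u2 : uniq t by case/andP: u1.
  have dkt l : l \in k :: t -> dom l by rewrite in_cons => /predU1P[->|/dt].
  have i1 := indX u1 (fun l lt => conj (dkt l lt) (gE' l lt)).
  have i2 := indX u2 (fun l lt => conj (dt l lt) (gE l lt)).
  rewrite set_cons bigcap_setU1 E'k E't big_cons E'k in i1.
  rewrite i1 {1}/E0 i2; congr (_ * _)%E; apply: eq_big_seq => l lt.
  by rewrite /E'; case: eqP => // lk; rewrite -lk lt in kt.
have := indep_pair_event (measurable_xi dk) mTs mE0 hE.
have mC : measurable ((fun z : R * R => z.1 + z.2) @^-1` B).
  have ma : measurable_fun setT (fun z : R * R => z.1 + z.2) by exact: measurable_funD.
  by rewrite -[X in measurable X]setTI; exact: ma.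
move=> /(_ _ mC).
rewrite (_ : (fun w => (xi k w, Ts w)) @^-1` _ = sumxi (k :: s) @^-1` B)//.
by apply/seteqP; split => w /=; rewrite big_cons.
Qed.

Lemma gaussian_moments_sum (s : seq I) (v : I -> R) :
  uniq s -> (forall k, k \in s -> dom k) ->
  (forall k, k \in s -> gaussian_moments P (xi k) (v k)) ->
  gaussian_moments P (fun w => \sum_(k <- s) xi k w) (\sum_(k <- s) v k).
Proof.
elim: s => [|k s ih] us ds gs.
  rewrite big_nil (_ : (fun _ => _) = fun=> 0); first exact: gaussian_moments0.
  by apply/funext => w; rewrite big_nil.
rewrite big_cons (_ : (fun _ => _) = fun w => xi k w + \sum_(k <- s) xi k w); last first.
  by apply/funext => w; rewrite big_cons.
apply: gaussian_momentsD.
- move=> A B mA mB; have dk : dom k by apply: ds; rewrite mem_head.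
  have := @indep_sum_event s [:: k] (fun=> xi k @^-1` A) B.
  rewrite set_cons1 bigcap_set1 setIC muleC => -> //.
  + by rewrite cats1 rcons_uniq.
  + by move=> l; rewrite mem_cat mem_seq1 orbC -in_cons; exact: ds.
  + by move=> l; rewrite mem_seq1 => /eqP ->; exact: xiX.
- by apply: gs; rewrite mem_head.
- case/andP: us => _ us; apply: ih => // l ls; [apply: ds | apply: gs].
    by rewrite in_cons ls orbT.
  by rewrite in_cons ls orbT.
Qed.

End IndependentSums.

(** * Quadratic forms *)

Section Whitening.
Context {R : realType}.

Lemma spd_congr (p q : nat) (S : 'M[R]_p) (M : 'M[R]_(q, p)) :
  spd S -> (forall v : 'cV_q, v != 0 -> M^T *m v != 0) -> spd (M *m S *m M^T).
Proof.
move=> [Ssym Spos] Minj; split; first by rewrite !trmx_mul trmxK Ssym mulmxA.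
move=> v v0; have := Spos _ (Minj v v0).
by rewrite trmx_mul trmxK !mulmxA.
Qed.

(** Induction on the dimension by Gaussian elimination: after splitting off the pivot a, the Schur
    complement is again symmetric positive definite and is whitened by the induction hypothesis. *)
Lemma spd_whitening p (S : 'M[R]_p) : spd S -> exists A : 'M[R]_p, A *m S *m A^T = 1%:M.
Proof.
elim: p S => [|p ih] S spdS.
  by exists 1%:M; apply/matrixP; case.
move: S spdS; rewrite -[p.+1]/(1 + p)%N => S spdS.
have [Ssym Spos] := spdS.
pose a := S ord0 ord0.
pose b := dlsubmx S.
have ulE : ulsubmx S = a%:M.
  by apply/matrixP => i j; rewrite !ord1 !mxE /= mulr1n /a; congr (S _ _); apply: val_inj.
have urE : ursubmx S = b^T by rewrite /b trmx_dlsub Ssym.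
have SE : S = block_mx a%:M b^T b (drsubmx S) by rewrite -ulE -urE submxK.
have a0 : 0 < a.
  pose e : 'cV[R]_(1 + p) := delta_mx ord0 ord0.
  have e0 : e != 0.
    by apply/eqP => /matrixP /(_ ord0 ord0); rewrite !mxE eqxx => /eqP; rewrite oner_eq0.
  have := Spos e e0; rewrite /e trmx_delta -rowE -colE.
  by rewrite !mxE.
have an0 : a != 0 by rewrite gt_eqF.
(* These rows eliminate the first column of S, so [N *m S *m N^T] is the Schur complement of the
   pivot. *)
pose N : 'M[R]_(p, 1 + p) := row_mx (- a^-1 *: b) 1%:M.
have NSN : N *m S *m N^T = drsubmx S - a^-1 *: (b *m b^T).
  have h : (- a^-1 *: b) *m a%:M + b = 0.
    by rewrite mul_mx_scalar scalerA mulrN mulfV// scaleN1r addNr.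
  rewrite {1}SE /N mul_row_block !mul1mx h tr_row_mx mul_row_col mul0mx add0r.
  by rewrite trmx1 mulmx1 -scalemxAl scaleNr addrC.
have spdN : spd (N *m S *m N^T).
  apply: spd_congr => // v; apply: contra_neq => h.
  (* Injectivity of [N^T] is read off its lower block, which is the identity. *)
  have := congr1 dsubmx h; rewrite /N tr_row_mx mul_col_mx col_mxKd trmx1 mul1mx => ->.
  by apply/matrixP => i j; rewrite !mxE.
have [A' hA'] := ih _ spdN.
pose q := (Num.sqrt a)^-1.
(* The first row normalizes the pivot to 1; the remaining rows are [A' *m N], orthogonal to the
   first one for S. *)
exists (block_mx q%:M 0 (A' *m (- a^-1 *: b)) A').
have -> : block_mx q%:M 0 (A' *m (- a^-1 *: b)) A' = col_mx (row_mx q%:M 0) (A' *m N).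
  by rewrite /N mul_mx_row mulmx1 block_mxEv.
rewrite mul_col_mx tr_col_mx mul_col_row.
have -> : A' *m N *m S *m (A' *m N)^T = 1%:M by rewrite trmx_mul -hA' !mulmxA.
have h1 : row_mx q%:M 0 *m S = q *: row_mx a%:M b^T.
  by rewrite {1}SE mul_row_block !mul0mx !addr0 !mul_scalar_mx -scale_row_mx.
have -> : row_mx q%:M 0 *m S *m (row_mx q%:M 0)^T = 1%:M.
  rewrite h1 tr_row_mx -scalemxAl mul_row_col trmx0 mulmx0 addr0 tr_scalar_mx.
  rewrite -scalar_mxM scale_scalar_mx; congr (_%:M).
  by rewrite mulrCA -expr2 /q exprVn sqr_sqrtr ?ltW// mulfV.
have h2 : row_mx q%:M 0 *m S *m (A' *m N)^T = 0.
  rewrite h1 trmx_mul mulmxA -scalemxAl /N tr_row_mx mul_row_col trmx1 mulmx1.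
  rewrite linearZ /= mul_scalar_mx scalerA mulrN mulfV// scaleN1r addNr.
  by rewrite scaler0 mul0mx.
rewrite h2.
have -> : A' *m N *m S *m (row_mx q%:M 0)^T = 0.
  by apply: (can_inj (@trmxK _ _ _)); rewrite trmx0 -[RHS]h2 !trmx_mul !trmxK Ssym !mulmxA.
by rewrite -scalar_mx_block.
Qed.

(** From A S A^T = 1 follows S^-1 = A^T A, so the form is the dot product of A x and A y. The double
    transpose presents each coordinate as u^T x with u a column vector, the shape in which linear
    forms of W are controlled. *)
Lemma bilS_whitening p (S A : 'M[R]_p) (x y : 'cV[R]_p) : A *m S *m A^T = 1%:M ->
  bilS S x y = \sum_r ((row r A)^T^T *m x) ord0 ord0 * ((row r A)^T^T *m y) ord0 ord0.
Proof.
move=> h.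
have [uAS uAT] := mulmx1_unit h.
have uA : A \in unitmx by rewrite -unitmx_tr.
have uS : S \in unitmx by move: uAS; rewrite unitmx_mul => /andP[].
have -> : bilS S x y = ((A *m x)^T *m (A *m y)) ord0 ord0.
  rewrite /bilS trmx_mul !mulmxA; congr ((_ *m _) ord0 ord0).
  rewrite -mulmxA; congr (_ *m _).
  apply: (can_inj (mulKmx uS)); rewrite mulmxV//.
  apply: (can_inj (mulKmx uA)); rewrite mulmx1 !mulmxA h mul1mx.
  by [].
rewrite mxE; apply: eq_bigr => r _; rewrite !trmxK mxE -!row_mul !mxE.
by [].
Qed.

Lemma whitening_orthonormal p (S A : 'M[R]_p) r s : A *m S *m A^T = 1%:M ->
  ((row r A)^T^T *m S *m (row s A)^T) ord0 ord0 = (r == s)%:R.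
Proof.
move=> /matrixP/(_ r s); rewrite [in RHS]mxE => <-.
rewrite trmxK -row_mul !mxE; apply: eq_bigr => i _.
by rewrite !mxE.
Qed.

End Whitening.

Section QuadraticForms.
Context {R : realType} d (T : measurableType d) (P : probability T R).
Variables (p : nat) (S : 'M[R]_p) (W : T -> 'cV[R]_p) (tau : R).
Hypothesis spdS : spd S.
Hypothesis gW : forall u : 'cV[R]_p,
  gaussian_moments P (fun w => (u^T *m W w) ord0 ord0) (tau * (u^T *m S *m u) ord0 ord0).

(* Polarization gives E[x^2 y^2] for two linear forms x, y from the fourth moments
   of x, y, x + y and x - y, so no independence of coordinates is needed. *)
Lemma has_mean_sqr_sqr (u v : 'cV[R]_p) (e : R) :
  (u^T *m S *m u) ord0 ord0 = 1 -> (v^T *m S *m v) ord0 ord0 = 1 ->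
  (u^T *m S *m v) ord0 ord0 = e ->
  has_mean P (fun w => (u^T *m W w) ord0 ord0 ^+ 2 * (v^T *m W w) ord0 ord0 ^+ 2)
    ((1 + 2 * e ^+ 2) * tau ^+ 2).
Proof.
move=> uu vv uv.
have vu : (v^T *m S *m u) ord0 ord0 = e.
  rewrite -uv (_ : v^T *m S *m u = (u^T *m S *m v)^T) 1?mxE//.
  by rewrite !trmx_mul trmxK (proj1 spdS) mulmxA.
have [_ _ _ hu] := gW u; have [_ _ _ hv] := gW v.
have [_ _ _ hD] := gW (u + v); have [_ _ _ hB] := gW (u - v).
have aE (M N : 'M[R]_1) : (M + N) ord0 ord0 = M ord0 ord0 + N ord0 ord0 by rewrite mxE.
have nE (M : 'M[R]_1) : (- M) ord0 ord0 = - M ord0 ord0 by rewrite mxE.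
have tD : (u + v)^T = u^T + v^T by rewrite linearD.
have tB : (u - v)^T = u^T - v^T by rewrite linearB.
have eD w : ((u + v)^T *m W w) ord0 ord0 = (u^T *m W w) ord0 ord0 + (v^T *m W w) ord0 ord0.
  by rewrite tD mulmxDl aE.
have eB w : ((u - v)^T *m W w) ord0 ord0 = (u^T *m W w) ord0 ord0 - (v^T *m W w) ord0 ord0.
  by rewrite tB mulmxBl aE nE.
have qD : ((u + v)^T *m S *m (u + v)) ord0 ord0 = 2 + 2 * e.
  by rewrite tD !mulmxDl !mulmxDr !(aE, nE, uu, vv, uv, vu); ring.
have qB : ((u - v)^T *m S *m (u - v)) ord0 ord0 = 2 - 2 * e.
  by rewrite tB !mulmxBl !mulmxBr !(aE, nE, uu, vv, uv, vu); ring.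
(* The identity is 12 x^2 y^2 = (x + y)^4 + (x - y)^4 - 2 (x^4 + y^4). The variances of x + y and x
   - y are (2 + 2 e) tau and (2 - 2 e) tau. *)
apply: has_mean_eq (has_meanZ 12^-1
  (has_meanD (has_meanD hD hB) (has_meanZ (-2) (has_meanD hu hv)))) => [w|].
  by rewrite eD eB; field.
by rewrite qD qB uu vv; field.
Qed.

(** In whitened coordinates the square of the form is a double sum of x_r^2 x_s^2, with mean tau^2
    off the diagonal and 3 tau^2 on it. The total is (p^2 + 2 p) tau^2, and centring removes p^2
    tau^2. *)
Lemma has_mean_bilS_sqr : has_mean P
  (fun w => (bilS S (W w) (W w) - p%:R * tau) ^+ 2) (2 * p%:R * tau ^+ 2).
Proof.
have [A hA] := spd_whitening spdS.
pose x r w := ((row r A)^T^T *m W w) ord0 ord0.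
have QE w : bilS S (W w) (W w) = \sum_r x r w ^+ 2.
  by rewrite (bilS_whitening _ _ hA); apply: eq_bigr => r _; rewrite expr2.
have x2 r : has_mean P (fun w => x r w ^+ 2) tau.
  have [_ h _ _] := gW (row r A)^T.
  by apply: has_mean_eq h => //; rewrite (whitening_orthonormal _ _ hA) eqxx mulr1.
have x4 r s : has_mean P (fun w => x r w ^+ 2 * x s w ^+ 2)
    ((1 + 2 * (r == s)%:R) * tau ^+ 2).
  have := @has_mean_sqr_sqr (row r A)^T (row s A)^T (r == s)%:R.
  rewrite !(whitening_orthonormal _ _ hA) !eqxx => /(_ erefl erefl erefl).
  by apply: has_mean_eq => //; case: (r == s); rewrite ?expr1n ?expr0n.
have hQ := has_mean_sum (index_enum 'I_p) x2.
have hQQ := has_mean_sum (index_enum 'I_p) (fun r => has_mean_sum (index_enum 'I_p) (x4 r)).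
apply: has_mean_eq (has_meanD hQQ (has_meanD (has_meanZ (- 2 * (p%:R * tau)) hQ)
   (has_mean_cst P ((p%:R * tau) ^+ 2)))) => [w|].
  rewrite QE -big_distrlr /=.
  by move: (\sum_i _) => q; ring.
have -> : \sum_(i < p) \sum_(s < p) (1 + 2 * (i == s)%:R) * tau ^+ 2 =
    (p%:R ^+ 2 + 2 * p%:R) * tau ^+ 2.
  rewrite (eq_bigr (fun=> (p%:R + 2) * tau ^+ 2)) => [|i _].
    by rewrite sumr_const card_ord -mulr_natl; ring.
  rewrite -mulr_suml big_split /= sumr_const card_ord; congr ((_ + _) * _).
  by rewrite (bigD1 i)//= eqxx big1 ?addr0 ?mulr1// => j /negbTE; rewrite eq_sym => ->; rewrite mulr0.
by rewrite sumr_const card_ord -mulr_natl; ring.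
Qed.

(** This is the second moment of the linear form u = S^-1 b, for which u^T S u = b^T S^-1 b. *)
Lemma has_mean_bilS_linear_sqr (b : 'cV[R]_p) : has_mean P
  (fun w => bilS S b (W w) ^+ 2) (tau * bilS S b b).
Proof.
have [A hA] := spd_whitening spdS.
have [uAS uAT] := mulmx1_unit hA.
have uS : S \in unitmx.
  by move: uAS; rewrite unitmx_mul => /andP[].
have [Ssym _] := spdS.
have [_ h _ _] := gW (invmx S *m b).
have iT : (invmx S)^T = invmx S by rewrite trmx_inv Ssym.
apply: has_mean_eq h => [w|].
  by rewrite /bilS trmx_mul iT.
by rewrite /bilS trmx_mul iT -!mulmxA mulKVmx.
Qed.

End QuadraticForms.

(** * Moments of linear forms in the deviations of the sample means *)

Section SampleMeans.
Context {R : realType} d (T : measurableType d) (P : probability T R).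
Variables (p n0 n1 : nat) (S : 'M[R]_p) (mu0 mu1 : 'cV[R]_p) (X0 X1 : nat -> T -> 'cV[R]_p).
Let dom (ik : bool * nat) : Prop := (ik.2 < (if ik.1 then n1 else n0))%N.
Let X (ik : bool * nat) := if ik.1 then X1 ik.2 else X0 ik.2.
Hypothesis spdS : spd S.
Hypothesis gX0 : forall k, (k < n0)%N -> gaussian_vec P (X0 k) mu0 S.
Hypothesis gX1 : forall k, (k < n1)%N -> gaussian_vec P (X1 k) mu1 S.
Hypothesis indX : mutually_independent P dom X.

(** A coordinate is the linear form of a nonzero basis vector, and its measurability is part of
    [has_normal_law]. *)
Lemma gaussian_vec_measurable (Y : T -> 'cV[R]_p) (m : 'cV[R]_p) i :
  gaussian_vec P Y m S -> measurable_fun setT (fun w => Y w i ord0).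
Proof.
move=> gY; have e0 : (delta_mx i ord0 : 'cV[R]_p) != 0.
  by apply/eqP => /matrixP /(_ i ord0); rewrite !mxE !eqxx => /eqP; rewrite oner_eq0.
have [+ _] := gY _ e0; congr measurable_fun; apply/funext => w.
by rewrite trmx_delta -rowE mxE.
Qed.

Let mX k : dom k -> forall i, measurable_fun setT (fun w => X k w i ord0).
Proof.
case: k => -[] k /= dk i; apply: gaussian_vec_measurable.
  exact: gX1.
exact: gX0.
Qed.

Lemma measurable_smean n (Y : nat -> T -> 'cV[R]_p) i :
  (forall k, (k < n)%N -> measurable_fun setT (fun w => Y k w i ord0)) ->
  measurable_fun setT (fun w => smean n Y w i ord0).
Proof.
move=> mY; rewrite (_ : (fun _ => _) = fun w => n%:R^-1 * \sum_(k < n) Y k w i ord0).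
  by apply: measurable_funM => //; apply: measurable_sum => k; exact: mY.
by apply/funext => w; rewrite mxE summxE.
Qed.

(** Both samples are merged into one list of independent centred terms with weights a_i / n_i; the
    n_i terms of class i contribute n_i (a_i / n_i)^2 = a_i^2 / n_i to the variance factor. *)
Lemma gaussian_moments_sample (a0 a1 : R) (u : 'cV[R]_p) : (0 < n0)%N -> (0 < n1)%N ->
  gaussian_moments P
    (fun w => (u^T *m (a0 *: (smean n0 X0 w - mu0) + a1 *: (smean n1 X1 w - mu1))) ord0 ord0)
    ((a0 ^+ 2 / n0%:R + a1 ^+ 2 / n1%:R) * (u^T *m S *m u) ord0 ord0).
Proof.
move=> n0p n1p.
have n0n : n0%:R != 0 :> R by rewrite pnatr_eq0 -lt0n.
have n1n : n1%:R != 0 :> R by rewrite pnatr_eq0 -lt0n.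
pose c (k : bool * nat) : R := if k.1 then a1 / n1%:R else a0 / n0%:R.
pose mu (k : bool * nat) := if k.1 then mu1 else mu0.
pose xi k w := c k * ((u^T *m X k w) ord0 ord0 - (u^T *m mu k) ord0 ord0).
pose s := [seq (false, i) | i <- iota 0 n0] ++ [seq (true, i) | i <- iota 0 n1].
have us : uniq s.
  rewrite cat_uniq !map_inj_uniq ?iota_uniq; try by move=> ? ? [].
  by rewrite andbT; apply/hasPn => _ /mapP[i _ ->]; apply/mapP => -[].
have ds k : k \in s -> dom k.
  by rewrite mem_cat => /orP[] /mapP[i + ->]; rewrite mem_iota.
have gX k : dom k -> gaussian_vec P (X k) (mu k) S.
  by case: k => -[] k dk; [exact: gX1 | exact: gX0].
have gs k : k \in s -> gaussian_moments P (xi k) (c k ^+ 2 * (u^T *m S *m u) ord0 ord0).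
  move=> /ds /gX g; apply: gaussian_momentsZ.
  (* [gaussian_vec] is silent about the zero form, whose law is degenerate; there all moments are
     0. *)
  have [u0|u0] := eqVneq u 0.
    rewrite u0 trmx0 !mul0mx !mxE (_ : (fun _ => _) = fun=> 0); first exact: gaussian_moments0.
    by apply/funext => w; rewrite !mul0mx !mxE subrr.
  have uSu : 0 < (u^T *m S *m u) ord0 ord0 by apply: (proj2 spdS).
  rewrite -(sqr_sqrtr (ltW uSu)); apply: gaussian_moments_normal; first exact: g.
  by rewrite gt_eqF// sqrtr_gt0.
have xiX k : dom k -> forall B : set R, measurable B -> gen_events (X k) (xi k @^-1` B).
  by move=> _ B mB; exact: gen_events_linear.
have := gaussian_moments_sum indX mX xiX us ds gs.
congr gaussian_moments; last first.
  rewrite -mulr_suml; congr (_ * _).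
  rewrite big_cat /= !big_map /c /= !big_const_seq !count_predT !size_iota !iter_addr_0.
  by rewrite -(mulr_natr ((a0 / _) ^+ 2)) -(mulr_natr ((a1 / _) ^+ 2)); field; rewrite n0n n1n.
apply/funext => w; rewrite big_cat /= !big_map /xi /c /mu /X /=.
have sumE n (Y : nat -> T -> 'cV[R]_p) (m : 'cV[R]_p) (a : R) : n%:R != 0 :> R ->
    \sum_(j <- iota 0 n) a / n%:R * ((u^T *m Y j w) ord0 ord0 - (u^T *m m) ord0 ord0) =
    a * (u^T *m (smean n Y w - m)) ord0 ord0.
  move=> nn; rewrite -mulr_sumr sumrB big_const_seq count_predT size_iota iter_addr_0.
  rewrite mulmxBr /smean -scalemxAr mulmx_sumr.
  have -> : (n%:R^-1 *: (\sum_(i < n) u^T *m Y i w) - u^T *m m) ord0 ord0 =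
    n%:R^-1 * (\sum_(i < n) (u^T *m Y i w) ord0 ord0) - (u^T *m m) ord0 ord0.
    by rewrite -summxE; move: (u^T *m m) (\sum_i _) => ? ?; rewrite !mxE.
  rewrite -[in LHS](subn0 n) -/(index_iota 0 n) big_mkord.
  by rewrite subn0 -(mulr_natr ((u^T *m m) ord0 ord0)); move: (\sum_(i < n) _) => y; field.
rewrite !sumE//; set y0 := smean n0 X0 w - mu0; set y1 := smean n1 X1 w - mu1.
clearbody y0 y1.
by rewrite mulmxDr -!scalemxAr [RHS]mxE; congr (_ + _); rewrite [RHS]mxE.
Qed.

End SampleMeans.

(** * Convergence in probability *)

Section ProbabilityFilter.
Context {R : realType} (d : nat -> measure_display) (Om : forall p, measurableType (d p)).
Variable P : forall p, probability (Om p) R.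

(* Convergence in probability along the sequence of probability spaces is
   convergence along this filter. *)
Definition prob_filter : set_system {p & Om p} := fun A =>
  forall e : R, 0 < e -> \forall p \near \oo, exists E : set (Om p),
    [/\ measurable E, (P p (~` E) <= e%:E)%E & forall w, E w -> A (existT (fun p => Om p : Type) p w)].

Global Instance prob_filter_filter : ProperFilter prob_filter.
Proof.
split.
  (* Any tolerance below 1 would do: an empty event has a complement of probability 1. *)
  move=> /(_ 2^-1) h; have /h : 0 < 2^-1 :> R by rewrite invr_gt0.
  move=> [N _ /(_ N (leqnn _))] [E [mE + hE]].
  have -> : E = set0 by apply/seteqP; split => // w /hE.
  by rewrite setC0 probability_setT lee_fin; lra.
split.
- by move=> e e0; near=> p; exists setT; split => //; rewrite setCT measure0 lee_fin ltW.
- move=> A B hA hB e e0; have e20 : 0 < e / 2 by rewrite divr_gt0.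
  near=> p.
  have [E [mE PE hE]] : exists E : set (Om p), [/\ measurable E,
    (P p (~` E) <= (e / 2)%:E)%E & forall w, E w -> A (existT (fun p => Om p : Type) p w)].
    by near: p; exact: hA.
  have [F [mF PF hF]] : exists E : set (Om p), [/\ measurable E,
    (P p (~` E) <= (e / 2)%:E)%E & forall w, E w -> B (existT (fun p => Om p : Type) p w)].
    by near: p; exact: hB.
  exists (E `&` F); split; first exact: measurableI.
    rewrite setCI (le_trans (measureU2 _ _ _)) //; try exact: measurableC.
    by rewrite [e in X in (_ <= X)%E]splitr EFinD leeD.
  by move=> w [/hE ? /hF ?].
- move=> A B AB hA e e0; near=> p.
  have [E [mE PE hE]] : exists E : set (Om p), [/\ measurable E,
    (P p (~` E) <= e%:E)%E & forall w, E w -> A (existT (fun p => Om p : Type) p w)].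
    by near: p; exact: hA.
  by exists E; split => // w /hE /AB.
Unshelve. all: by end_near. Qed.

Lemma prob_filter_near (A : set nat) : (\forall p \near \oo, A p) ->
  \forall z \near prob_filter, A (projT1 z).
Proof.
move=> hA e e0; near=> p; exists setT; split => //.
  by rewrite setCT measure0 lee_fin ltW.
by move=> w _ /=; near: p.
Unshelve. all: by end_near. Qed.

Lemma cvg_prob_projT1 : (fun z : {p & Om p} => projT1 z) @ prob_filter --> \oo.
Proof. by move=> A hA; exact: prob_filter_near. Qed.

Lemma cvg_prob_seq (a : nat -> R) (l : R) : a @ \oo --> l ->
  (fun z => a (projT1 z)) @ prob_filter --> l.
Proof. by move=> al; apply: cvg_comp al; exact: cvg_prob_projT1. Qed.

Lemma has_mean_le (p : nat) (X Y : Om p -> R) a b : (forall w, X w <= Y w) ->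
  has_mean (P p) X a -> has_mean (P p) Y b -> a <= b.
Proof.
move=> XY [iX eX] [iY eY]; rewrite -lee_fin -eX -eY.
by apply: (le_integral measurableT iX iY) => w _; rewrite lee_fin.
Qed.

Lemma has_mean_indic (p : nat) (A : set (Om p)) : measurable A ->
  has_mean (P p) \1_A (fine (P p A)).
Proof.
move=> mA; split; first exact: integrable_indic.
by rewrite integral_indic// setIT fineK// fin_num_measure.
Qed.

(** Chebyshev's inequality, from e^2 times the indicator of |Y| > e being at most Y^2. The moments
    are asked for only at large p, because the sample sizes may vanish at small p. *)
Lemma cvg_prob_of_sqr (Y : {p & Om p} -> R) (v : nat -> R) :
  (\forall p \near \oo, measurable_fun setT (fun w => Y (existT (fun p => Om p : Type) p w)) /\
     has_mean (P p) (fun w => Y (existT (fun p => Om p : Type) p w) ^+ 2) (v p)) ->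
  v @ \oo --> 0 -> Y @ prob_filter --> 0.
Proof.
move=> hY v0; apply/cvgr0Pnorm_le => e e0 /= e' e'0.
(* A second moment below e^2 e' forces the probability of |Y| > e below e'. *)
have ee : 0 < e ^+ 2 * e' by rewrite mulr_gt0// exprn_gt0.
have [+ _] := @cvgr0Pnorm_le R R nat \oo _ v; move=> /(_ v0 _ ee) hv.
near=> p.
have [mY mean] : measurable_fun setT (fun w => Y (existT (fun p => Om p : Type) p w)) /\
     has_mean (P p) (fun w => Y (existT (fun p => Om p : Type) p w) ^+ 2) (v p) by near: p.
have vp : `|v p| <= e ^+ 2 * e' by near: p.
pose E := [set w | `|Y (existT (fun p => Om p : Type) p w)| <= e].
have mE : measurable E.
  rewrite -[E]setTI.
  have -> : E = (fun w => `|Y (existT (fun p => Om p : Type) p w)|) @^-1` `]-oo, e].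
    by apply/seteqP; split => w /=; rewrite in_itv.
  by have := measurableT_comp (@normr_measurable R setT) mY; exact.
exists E; split => //.
have mEC := measurableC mE.
have := has_mean_le _ (has_meanZ (e ^+ 2) (has_mean_indic mEC)) mean.
have h w : e ^+ 2 * \1_(~` E) w <= Y (existT (fun p => Om p : Type) p w) ^+ 2.
  rewrite indicE; case: (boolP (w \in ~` E)) => [|_]; last by rewrite mulr0 sqr_ge0.
  rewrite inE /E /= => /negP; rewrite -ltNge => eY.
  rewrite mulr1 -[leRHS]real_normK ?num_real// lerXn2r ?nnegrE// ltW//.
move=> /(_ h) hv'.
rewrite -(fineK (fin_num_measure (P p) _ mEC)) lee_fin.
rewrite -(ler_pM2l (exprn_gt0 2 e0)) (le_trans hv')// (le_trans (ler_norm _))//.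
Unshelve. all: by end_near. Qed.

Lemma cvg_mean (Y : {p & Om p} -> R) (l : R) :
  (forall p, measurable_fun setT (fun w => Y (existT (fun p => Om p : Type) p w))) ->
  (forall z, 0 <= Y z <= 1) -> Y @ prob_filter --> l ->
  (fun p => \int[P p]_w (Y (existT (fun p => Om p : Type) p w))%:E)%E @ \oo --> l%:E.
Proof.
move=> mY Y01 Yl.
have hm p : has_mean (P p) (fun w => Y (existT (fun p => Om p : Type) p w))
    (fine (\int[P p]_w (Y (existT (fun p => Om p : Type) p w))%:E)%E).
  have iY : (P p).-integrable setT (EFin \o (fun w => Y (existT (fun p => Om p : Type) p w))).
    have [i1 _] := has_mean_cst (P p) (1 : R).
    apply: (le_integrable measurableT _ _ i1); first exact/measurable_EFinP.
    move=> w _ /=; rewrite lee_fin normr1; have /andP[? ?] := Y01 (existT (fun p => Om p : Type) p w).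
    by rewrite ger0_norm.
  by split => //; rewrite fineK//; exact: (integrable_fin_num measurableT iY).
rewrite (_ : (fun p => _) = EFin \o (fun p => fine (\int[P p]_w (Y (existT (fun p => Om p : Type) p w))%:E)%E)).
  apply: cvg_EFin; first exact: nearW.
  apply/cvgrPdist_le => e e0.
  (* [K] bounds the distance from [l] to any point of [0, 1]. The mean is thus within e / 2 of [l]
     up to K times the probability of the exceptional event, itself at most e / 2. *)
  pose K := 1 + `|l|.
  have K0 : 0 < K by rewrite ltr_pwDl.
  have e20 : 0 < e / 2 by rewrite divr_gt0.
  have eK : 0 < e / 2 / K by rewrite divr_gt0.
  move/cvgrPdist_le : Yl => /(_ _ e20) /(_ _ eK) hE.
  near=> p.
  have [E [mE PE hE']] : exists E : set (Om p), [/\ measurable E,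
    (P p (~` E) <= (e / 2 / K)%:E)%E & forall w, E w -> `|l - Y (existT (fun p => Om p : Type) p w)| <= e / 2].
    by near: p.
  have mEC := measurableC mE.
  have hi := has_mean_indic mEC.
  have PEf : fine (P p (~` E)) <= e / 2 / K.
    by rewrite -lee_fin fineK// fin_num_measure.
  have KP : K * fine (P p (~` E)) <= e / 2 by rewrite mulrC -ler_pdivlMr.
  have ub w : Y (existT (fun p => Om p : Type) p w) <= (l + e / 2) + K * \1_(~` E) w.
    rewrite indicE; case: (boolP (w \in ~` E)) => [_|].
      have /andP[_ y1] := Y01 (existT (fun p => Om p : Type) p w); rewrite (le_trans y1)// mulr1.
      have := ler_norm (- l); rewrite normrN /K; lra.
    rewrite notin_setE /= => /contrapT /hE'; rewrite ler_norml; lra.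
  have lb w : (l - e / 2) + (- K) * \1_(~` E) w <= Y (existT (fun p => Om p : Type) p w).
    rewrite indicE; case: (boolP (w \in ~` E)) => [_|].
      have /andP[y0 _] := Y01 (existT (fun p => Om p : Type) p w); rewrite (le_trans _ y0)// mulr1.
      have := ler_norm l; rewrite /K; lra.
    rewrite notin_setE /= => /contrapT /hE'; rewrite ler_norml; lra.
  have h1 := has_mean_le ub (hm p) (has_meanD (has_mean_cst (P p) _) (has_meanZ K hi)).
  have h2 := has_mean_le lb (has_meanD (has_mean_cst (P p) _) (has_meanZ (- K) hi)) (hm p).
  rewrite ler_norml; move: h1 h2 KP; rewrite mulNr /=; move: (K * _) (fine _) => a b; lra.
by apply/funext => p /=; rewrite -(proj2 (hm p)).
Unshelve. all: by end_near. Qed.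

End ProbabilityFilter.

(** * Bounds and continuity of the standard normal distribution function *)

Section NormalCDF.
Context {R : realType}.

Lemma Phi_ge0 (x : R) : 0 <= Phi x.
Proof. by rewrite fine_ge0. Qed.

Lemma Phi_le1 (x : R) : Phi x <= 1.
Proof.
rewrite -lee_fin fineK; last by rewrite fin_num_measure.
exact: probability_le1.
Qed.

(** The increment is the mass of []x, y]], and the density never exceeds its peak; hence a Lipschitz
    bound. *)
Lemma Phi_bound (x y : R) : x <= y -> 0 <= Phi y - Phi x <= normal_peak 1 * (y - x).
Proof.
move=> xy.
have fin A : measurable A -> normal_prob (0 : R) 1 A \is a fin_num by exact: fin_num_measure.
have -> : Phi y - Phi x = fine (normal_prob (0 : R) 1 `]x, y]).
  rewrite /Phi (_ : `]-oo, y]%classic = `]-oo, x]%classic `|` `]x, y]%classic); last first.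
    by rewrite -itv_bndbnd_setU.
  rewrite measureU//; last by rewrite -subset0 => z [] /=; rewrite !in_itv/= => ? ; lra.
  by rewrite fineD ?fin// addrC addKr.
rewrite fine_ge0//= -lee_fin fineK ?fin//.
apply: (@le_trans _ _ (\int[lebesgue_measure]_(z in `]x, y]) (normal_peak 1)%:E))%E.
  apply: ge0_le_integral => //.
  - by move=> z _; rewrite lee_fin normal_pdf_ge0.
  - by apply/measurable_EFinP; apply: measurable_funTS; exact: measurable_normal_pdf.
  - by move=> z _; rewrite lee_fin normal_pdf_ub// oner_eq0.
rewrite integral_cst//= lebesgue_measure_itv/= lte_fin; case: ifP => _ //.
by rewrite mule0 lee_fin mulr_ge0 ?normal_peak_ge0 ?subr_ge0.
Qed.

Lemma Phi_continuous : continuous (@Phi R).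
Proof.
have pk : 0 < normal_peak (1 : R) by rewrite normal_peak_gt0// oner_eq0.
move=> x; apply/cvgrPdist_le => e e0; near=> y.
have : `|x - y| <= e / normal_peak 1.
  by near: y; apply: cvgr_dist_le; [exact: cvg_id | rewrite divr_gt0].
rewrite ler_pdivlMr// mulrC; apply: le_trans.
have [xy|/ltW yx] := leP x y.
  have /andP[h1 h2] := Phi_bound xy.
  by rewrite distrC ger0_norm// distrC ger0_norm ?subr_ge0.
have /andP[h1 h2] := Phi_bound yx.
by rewrite ger0_norm// ger0_norm ?subr_ge0.
Unshelve. all: by end_near. Qed.

Lemma measurable_Phi : measurable_fun setT (@Phi R).
Proof. exact: continuous_measurable_fun Phi_continuous. Qed.

End NormalCDF.

(** * The error estimator *)

Section BilinearForm.
Context {R : realType} (p : nat) (S : 'M[R]_p).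
Implicit Types x y z : 'cV[R]_p.

Lemma bilSDl x y z : bilS S (x + y) z = bilS S x z + bilS S y z.
Proof. by rewrite /bilS linearD /= !mulmxDl mxE. Qed.

Lemma bilSDr x y z : bilS S x (y + z) = bilS S x y + bilS S x z.
Proof. by rewrite /bilS mulmxDr mxE. Qed.

Lemma bilSZl a x y : bilS S (a *: x) y = a * bilS S x y.
Proof. by rewrite /bilS linearZ /= -!scalemxAl mxE. Qed.

Lemma bilSZr a x y : bilS S x (a *: y) = a * bilS S x y.
Proof. by rewrite /bilS -scalemxAr mxE. Qed.

Lemma bilSBl x y z : bilS S (x - y) z = bilS S x z - bilS S y z.
Proof. by rewrite bilSDl -scaleN1r bilSZl mulN1r. Qed.

Lemma bilSBr x y z : bilS S x (y - z) = bilS S x y - bilS S x z.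
Proof. by rewrite bilSDr -scaleN1r bilSZr mulN1r. Qed.

Hypothesis spdS : spd S.

Lemma bilSC x y : bilS S x y = bilS S y x.
Proof.
rewrite /bilS (_ : y^T *m _ *m x = (x^T *m invmx S *m y)^T) ?mxE//.
by rewrite !trmx_mul trmxK trmx_inv (proj1 spdS) mulmxA.
Qed.

Lemma etaSE x y : etaS S x y = bilS S x x - 2 * bilS S x y + bilS S y y.
Proof. by rewrite /etaS bilSBl !bilSBr (bilSC y x); ring. Qed.

(** The discriminant is reduced to inner products whose limits can be found separately. By symmetry
    the midpoint contributes only the difference of the two squared norms. *)
Lemma bilS_discriminant (n nu : R) (m x x0 x1 : 'cV[R]_p) :
  bilS S ((n + nu)^-1 *: (n *: x + nu *: m) - 2^-1 *: (x0 + x1)) (x0 - x1) =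
  n / (n + nu) * (bilS S x x0 - bilS S x x1) +
  nu / (n + nu) * (bilS S m x0 - bilS S m x1) - 2^-1 * (bilS S x0 x0 - bilS S x1 x1).
Proof.
rewrite bilSBl !bilSZl !bilSDl !bilSZl !bilSBr (bilSC x1 x0).
by move: ((n + nu)^-1) => q; ring.
Qed.

End BilinearForm.

(** * Measurability of the estimator *)

Section MeasurableEstimator.
Context {R : realType} d (T : measurableType d) (p : nat).
Implicit Types f g : T -> 'cV[R]_p.

Definition measurable_vec f := forall i, measurable_fun setT (fun w => f w i ord0).

Lemma measurable_vec_cst a : measurable_vec (fun=> a).
Proof. by move=> i; exact: measurable_cst. Qed.

Lemma measurable_vecD f g : measurable_vec f -> measurable_vec g ->
  measurable_vec (fun w => f w + g w).
Proof.
move=> mf mg i; rewrite (_ : (fun _ => _) = fun w => f w i ord0 + g w i ord0).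
  exact: measurable_funD.
by apply/funext => w; rewrite mxE.
Qed.

Lemma measurable_vecZ a f : measurable_vec f -> measurable_vec (fun w => a *: f w).
Proof.
move=> mf i; rewrite (_ : (fun _ => _) = fun w => a * f w i ord0).
  exact: measurable_funM.
by apply/funext => w; rewrite mxE.
Qed.

Lemma measurable_vecB f g : measurable_vec f -> measurable_vec g ->
  measurable_vec (fun w => f w - g w).
Proof.
move=> mf mg; rewrite (_ : (fun _ => _) = fun w => f w + (-1) *: g w).
  by apply: measurable_vecD => //; exact: measurable_vecZ.
by apply/funext => w; rewrite scaleN1r.
Qed.

Lemma measurable_bilS (S : 'M[R]_p) f g : measurable_vec f -> measurable_vec g ->
  measurable_fun setT (fun w => bilS S (f w) (g w)).
Proof.
move=> mf mg; rewrite (_ : (fun _ => _) = fun w =>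
    \sum_j (\sum_i f w i ord0 * invmx S i j) * g w j ord0).
  apply: measurable_sum => j; apply: measurable_funM => //.
  by apply: measurable_sum => i; apply: measurable_funM.
apply/funext => w; rewrite /bilS mxE; apply: eq_bigr => j _; rewrite mxE; congr (_ * _).
by apply: eq_bigr => i _; rewrite mxE.
Qed.

(** The denominator may vanish, so division is expressed by the real power -1, which is measurable
    and agrees with the inverse on nonnegative numbers, including the value 0 at 0. *)
Lemma measurable_div_sqrt (u v : T -> R) : measurable_fun setT u -> measurable_fun setT v ->
  measurable_fun setT (fun w => u w / Num.sqrt (v w)).
Proof.
move=> mu mv; rewrite (_ : (fun _ => _) = fun w => u w * (Num.sqrt (v w) `^ (-1))).
  apply: measurable_funM => //.
  apply: (measurableT_comp (@measurable_powR R (-1))).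
  apply: (measurableT_comp _ mv); apply: continuous_measurable_fun.
  exact: sqrt_continuous.
by apply/funext => w; rewrite powR_inv1// sqrtr_ge0.
Qed.

Lemma measurable_epsB (S : 'M[R]_p) (alpha0 : R) n0 n1 nu0 nu1 m0 m1 f g i :
  measurable_vec f -> measurable_vec g ->
  measurable_fun setT (fun w => epsB S alpha0 n0 n1 nu0 nu1 m0 m1 (f w) (g w) i).
Proof.
move=> mf mg; rewrite /epsB; apply: (measurableT_comp measurable_Phi).
have mB := measurable_vecB mf mg.
apply: measurable_funM => //; apply: measurable_funM => //.
apply: measurable_div_sqrt; last exact: measurable_bilS.
apply: measurable_funD => //; apply: measurableT_comp => //.
apply: measurable_bilS => //; apply: measurable_vecB.
  apply: measurable_vecZ; apply: measurable_vecD; last exact: measurable_vec_cst.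
  by apply: measurable_vecZ; case: i.
by apply: measurable_vecZ; exact: measurable_vecD.
Qed.

Lemma epsB_itv (S : 'M[R]_p) (alpha0 : R) n0 n1 nu0 nu1 m0 m1 x0 x1 i :
  0 <= epsB S alpha0 n0 n1 nu0 nu1 m0 m1 x0 x1 i <= 1.
Proof. by rewrite Phi_ge0 Phi_le1. Qed.

End MeasurableEstimator.

(** Stated for an arbitrary filter in order to apply to convergence in probability. Positivity of b,
    to be supplied by D > 0, keeps the limiting denominator away from 0, and r stands for the
    shrinkage factor. *)
Lemma cvg_Phi_ratio (R : realType) (T : Type) (F : set_system T) {FF : Filter F}
    (num den r : T -> R) (a b e : R) :
  num @ F --> a -> den @ F --> b -> 0 < b -> r @ F --> (1 : R) ->
  (fun z => Phi (e * (num z / Num.sqrt (den z) * r z))) @ F --> Phi (e * (a / Num.sqrt b)).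
Proof.
move=> numa denb b0 r1.
have cden : (fun z => Num.sqrt (den z)) @ F --> Num.sqrt b.
  exact: (continuous_cvg _ (@sqrt_continuous R b) denb).
have sb0 : Num.sqrt b != 0 by rewrite gt_eqF// sqrtr_gt0.
have carg : (fun z => e * (num z / Num.sqrt (den z) * r z)) @ F --> e * (a / Num.sqrt b * 1).
  apply: cvgM; first exact: cvg_cst.
  by apply: cvgM => //; apply: cvgM => //; exact: cvgV.
rewrite -[a / _]mulr1.
exact: (continuous_cvg _ (@Phi_continuous R _) carg).
Qed.

(** * Limits of the sample and prior weights *)

Section SampleSizeSequences.
Context {R : realType}.

Lemma cvg_invn (n : nat -> nat) : (fun p => (n p)%:R : R) @ \oo --> +oo ->
  (fun p => (n p)%:R^-1 : R) @ \oo --> 0.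
Proof.
move=> ny; have h : \forall p \near \oo, (0 : R) < (n p)%:R by exact: cvgry_gt.
exact: (proj2 (gtr0_cvgV0 h) ny).
Qed.

Lemma near_pos (n : nat -> nat) : (fun p => (n p)%:R : R) @ \oo --> +oo ->
  \forall p \near \oo, (0 < n p)%N.
Proof.
move=> ny; have h : \forall p \near \oo, (0 : R) < (n p)%:R by exact: cvgry_gt.
by apply: filterS h => p; rewrite ltr0n.
Qed.

Lemma ratio_limit_ge0 (n : nat -> nat) (nu : nat -> R) (g : R) :
  (forall p, 0 < nu p) -> (fun p => nu p / (n p)%:R) @ \oo --> g -> 0 <= g.
Proof.
move=> nu0p h; rewrite -(cvg_lim (@Rhausdorff R) h); apply: limr_ge.
  by apply/cvg_ex; exists g.
by near=> p; rewrite divr_ge0// ltW.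
Unshelve. all: by end_near. Qed.

(** The weight equals 1 / (1 + nu / n) as soon as n > 0, hence only eventually. *)
Lemma cvg_sample_weight (n : nat -> nat) (nu : nat -> R) (g : R) :
  (fun p => (n p)%:R : R) @ \oo --> +oo -> (forall p, 0 < nu p) ->
  (fun p => nu p / (n p)%:R) @ \oo --> g ->
  (fun p => (n p)%:R / ((n p)%:R + nu p)) @ \oo --> (1 + g)^-1.
Proof.
move=> ny nup h; have g0' := ratio_limit_ge0 nup h.
have : (fun p => (1 + nu p / (n p)%:R)^-1) @ \oo --> (1 + g)^-1.
  apply: cvgV; first by rewrite gt_eqF// ltr_pwDl.
  by apply: cvgD => //; exact: cvg_cst.
apply: cvg_trans; apply: near_eq_cvg; near=> p.
have np : (0 : R) < (n p)%:R by rewrite ltr0n; near: p; exact: near_pos.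
have nup' := nup p.
by field; rewrite !gt_eqF// addr_gt0.
Unshelve. all: by end_near. Qed.

Lemma cvg_prior_weight (n : nat -> nat) (nu : nat -> R) (g : R) :
  (fun p => (n p)%:R : R) @ \oo --> +oo -> (forall p, 0 < nu p) ->
  (fun p => nu p / (n p)%:R) @ \oo --> g ->
  (fun p => nu p / ((n p)%:R + nu p)) @ \oo --> g / (1 + g).
Proof.
move=> ny nup h; have g0' := ratio_limit_ge0 nup h.
have -> : g / (1 + g) = 1 - (1 + g)^-1 by field; rewrite gt_eqF// ltr_pwDl.
rewrite (_ : (fun p => _) = fun p => 1 - (n p)%:R / ((n p)%:R + nu p)).
  by apply: cvgB; [exact: cvg_cst | exact: cvg_sample_weight].
apply/funext => p; have nup' := nup p; have : (0 : R) <= (n p)%:R by [].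
by move=> ?; field; rewrite gt_eqF// ltr_wpDl.
Qed.

(** With nu* = n + nu the ratio is 1 - 1 / (nu* + 1), and nu* tends to infinity; this is why the
    factor leaves no trace in the limit. *)
Lemma cvg_shrinkage (n : nat -> nat) (nu : nat -> R) :
  (fun p => (n p)%:R : R) @ \oo --> +oo -> (forall p, 0 < nu p) ->
  (fun p => Num.sqrt (((n p)%:R + nu p) / ((n p)%:R + nu p + 1))) @ \oo --> (1 : R).
Proof.
move=> ny nup.
have h : (fun p => ((n p)%:R + nu p + 1)^-1) @ \oo --> (0 : R).
  apply: (@squeeze_cvgr _ _ _ _ (cst 0) (fun p => (n p)%:R^-1)); last 2 first.
  - exact: cvg_cst.
  - exact: cvg_invn.
  near=> p => /=; have np : (0 : R) < (n p)%:R by rewrite ltr0n; near: p; exact: near_pos.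
  have nup' := nup p.
  rewrite invr_ge0 !addr_ge0 ?(ltW np) ?(ltW nup')//= lef_pV2 ?posrE ?addr_gt0//.
  by rewrite -addrA lerDl addr_ge0// ltW.
have h1 : (fun p => ((n p)%:R + nu p) / ((n p)%:R + nu p + 1)) @ \oo --> (1 : R).
  rewrite -[X in _ --> X](subr0 1).
  rewrite (_ : (fun p => _) = fun p => 1 - ((n p)%:R + nu p + 1)^-1).
    by apply: cvgB => //; exact: cvg_cst.
  apply/funext => p; have nup' := nup p; have : (0 : R) <= (n p)%:R by [].
  by move=> ?; field; rewrite gt_eqF// ltr_wpDl// addr_ge0// ltW.
by have := cvg_comp _ _ h1 (@sqrt_continuous R 1); rewrite sqrtr1.
Unshelve. all: by end_near. Qed.

End SampleSizeSequences.

(** * Limits in probability of the inner products and of the estimator *)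

Section Asymptotics.
Context {R : realType} (d : nat -> measure_display) (Om : forall p, measurableType (d p)).
Variables (P : forall p, probability (Om p) R) (S : forall p, 'M[R]_p).
Variables (mu0 mu1 m0 m1 : forall p, 'cV[R]_p) (n0 n1 : nat -> nat) (nu0 nu1 : nat -> R).
Variables (X0 X1 : forall p, nat -> Om p -> 'cV[R]_p) (J0 J1 g0 g1 : R).
Arguments X0 : clear implicits.
Arguments X1 : clear implicits.
Hypothesis spdS : forall p, spd (S p).
Hypothesis gX0 : forall p k, (k < n0 p)%N -> gaussian_vec (P p) (X0 p k) (mu0 p) (S p).
Hypothesis gX1 : forall p k, (k < n1 p)%N -> gaussian_vec (P p) (X1 p k) (mu1 p) (S p).
Hypothesis indX : forall p, mutually_independent (P p)
  (fun ik : bool * nat => (ik.2 < (if ik.1 then n1 p else n0 p))%N)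
  (fun ik : bool * nat => if ik.1 then X1 p ik.2 else X0 p ik.2).
Hypothesis n0y : (fun p => (n0 p)%:R : R) @ \oo --> +oo.
Hypothesis n1y : (fun p => (n1 p)%:R : R) @ \oo --> +oo.
Hypothesis nu_gt0 : forall p, 0 < nu0 p /\ 0 < nu1 p.
Hypothesis pn0 : (fun p => p%:R / (n0 p)%:R : R) @ \oo --> J0.
Hypothesis pn1 : (fun p => p%:R / (n1 p)%:R : R) @ \oo --> J1.
Hypothesis nun0 : (fun p => nu0 p / (n0 p)%:R) @ \oo --> g0.
Hypothesis nun1 : (fun p => nu1 p / (n1 p)%:R) @ \oo --> g1.

Let xb0 p (w : Om p) := smean (n0 p) (X0 p) w.
Let xb1 p (w : Om p) := smean (n1 p) (X1 p) w.
Let dev a0 a1 p (w : Om p) : 'cV[R]_p := a0 *: (xb0 w - mu0 p) + a1 *: (xb1 w - mu1 p).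
Let F := prob_filter P.
Let onF (f : forall p, Om p -> R) (z : {p & Om p}) : R := f (projT1 z) (projT2 z).

Let mxb0 p : measurable_vec (@xb0 p).
Proof.
by move=> i; apply: measurable_smean => k kn; apply: gaussian_vec_measurable (gX0 kn).
Qed.

Let mxb1 p : measurable_vec (@xb1 p).
Proof.
by move=> i; apply: measurable_smean => k kn; apply: gaussian_vec_measurable (gX1 kn).
Qed.

Let mdev a0 a1 p : measurable_vec (@dev a0 a1 p).
Proof.
apply: measurable_vecD; apply: measurable_vecZ; apply: measurable_vecB => //;
  exact: measurable_vec_cst.
Qed.

Let tau a0 a1 p : R := a0 ^+ 2 / (n0 p)%:R + a1 ^+ 2 / (n1 p)%:R.

Let cvg_tau a0 a1 : tau a0 a1 @ \oo --> 0.
Proof.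
rewrite (_ : 0 = a0 ^+ 2 * 0 + a1 ^+ 2 * 0); last by ring.
by apply: cvgD; apply: cvgM; (exact: cvg_cst || exact: cvg_invn).
Qed.

Let cvg_ptau a0 a1 : (fun p => p%:R * tau a0 a1 p) @ \oo --> a0 ^+ 2 * J0 + a1 ^+ 2 * J1.
Proof.
rewrite (_ : (fun p => _) = fun p => a0 ^+ 2 * (p%:R / (n0 p)%:R) + a1 ^+ 2 * (p%:R / (n1 p)%:R)).
  by apply: cvgD; apply: cvgM => //; exact: cvg_cst.
by apply/funext => p; rewrite /tau; ring.
Qed.

Let gdev a0 a1 : \forall p \near \oo, forall u : 'cV[R]_p,
  gaussian_moments (P p) (fun w => (u^T *m dev a0 a1 w) ord0 ord0)
    (tau a0 a1 p * (u^T *m S p *m u) ord0 ord0).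
Proof.
near=> p => u; apply: (gaussian_moments_sample (spdS p) (@gX0 p) (@gX1 p) (@indX p)).
  by near: p; exact: (near_pos n0y).
by near: p; exact: (near_pos n1y).
Unshelve. all: by end_near. Qed.

Lemma cvg_bilS_dev a0 a1 :
  onF (fun p w => bilS (S p) (dev a0 a1 w) (dev a0 a1 w)) @ F --> a0 ^+ 2 * J0 + a1 ^+ 2 * J1.
Proof.
rewrite (_ : onF _ = fun z : {p & Om p} =>
   onF (fun p w => bilS (S p) (dev a0 a1 w) (dev a0 a1 w) - p%:R * tau a0 a1 p) z
   + (fun p => p%:R * tau a0 a1 p) (projT1 z)); last first.
  by apply/funext => z; rewrite /onF subrK.
rewrite -[X in _ --> X]add0r; apply: cvgD; last exact: (cvg_prob_seq P (@cvg_ptau a0 a1)).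
apply: (cvg_prob_of_sqr (v := fun p => 2 * p%:R * tau a0 a1 p ^+ 2)).
  near=> p; rewrite /onF; split => /=.
    have mB := measurable_bilS (S p) (@mdev a0 a1 p) (@mdev a0 a1 p).
    exact: (measurable_funB mB (measurable_cst _)).
  by apply: (has_mean_bilS_sqr (spdS p)); near: p; exact: gdev.
(* The variance is grouped as a convergent factor p tau times a factor tau tending to 0. *)
rewrite (_ : (fun p => _) = fun p => 2 * (p%:R * tau a0 a1 p) * tau a0 a1 p); last first.
  by apply/funext => p; ring.
rewrite -[X in _ --> X](mulr0 (2 * (a0 ^+ 2 * J0 + a1 ^+ 2 * J1))).
by apply: cvgM => //; apply: cvgM => //; exact: cvg_cst.
Unshelve. all: by end_near. Qed.

Lemma cvg_bilS_cst_dev a0 a1 (b : forall p, 'cV[R]_p) :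
  cvgn (fun p => bilS (S p) (b p) (b p)) ->
  onF (fun p w => bilS (S p) (b p) (dev a0 a1 w)) @ F --> 0.
Proof.
move=> /cvg_ex[l bl].
apply: (cvg_prob_of_sqr (v := fun p => tau a0 a1 p * bilS (S p) (b p) (b p))).
  near=> p; rewrite /onF; split => /=.
    exact: (measurable_bilS (S p) (measurable_vec_cst _) (@mdev a0 a1 p)).
  by apply: (has_mean_bilS_linear_sqr (spdS p)); near: p; exact: gdev.
by rewrite -(mul0r l); apply: cvgM.
Unshelve. all: by end_near. Qed.

Let dev10 p (w : Om p) : xb0 w = mu0 p + dev 1 0 w.
Proof. by rewrite /dev scale1r scale0r addr0 addrC subrK. Qed.

Let dev01 p (w : Om p) : xb1 w = mu1 p + dev 0 1 w.
Proof. by rewrite /dev scale1r scale0r add0r addrC subrK. Qed.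

Lemma cvg_bilS_xb0 (b : forall p, 'cV[R]_p) (l : R) :
  cvgn (fun p => bilS (S p) (b p) (b p)) ->
  (fun p => bilS (S p) (b p) (mu0 p)) @ \oo --> l ->
  onF (fun p w => bilS (S p) (b p) (xb0 w)) @ F --> l.
Proof.
move=> bb bl.
rewrite (_ : onF _ = fun z : {p & Om p} => bilS (S (projT1 z)) (b (projT1 z)) (mu0 (projT1 z))
   + onF (fun p w => bilS (S p) (b p) (dev 1 0 w)) z); last first.
  by apply/funext => -[p w]; rewrite /onF /=; rewrite dev10 bilSDr.
rewrite -[l]addr0; apply: cvgD; first exact: (cvg_prob_seq P bl).
exact: cvg_bilS_cst_dev.
Qed.

Lemma cvg_bilS_xb1 (b : forall p, 'cV[R]_p) (l : R) :
  cvgn (fun p => bilS (S p) (b p) (b p)) ->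
  (fun p => bilS (S p) (b p) (mu1 p)) @ \oo --> l ->
  onF (fun p w => bilS (S p) (b p) (xb1 w)) @ F --> l.
Proof.
move=> bb bl.
rewrite (_ : onF _ = fun z : {p & Om p} => bilS (S (projT1 z)) (b (projT1 z)) (mu1 (projT1 z))
   + onF (fun p w => bilS (S p) (b p) (dev 0 1 w)) z); last first.
  by apply/funext => -[p w]; rewrite /onF /=; rewrite dev01 bilSDr.
rewrite -[l]addr0; apply: cvgD; first exact: (cvg_prob_seq P bl).
exact: cvg_bilS_cst_dev.
Qed.

(** The noise does not average out in the squared norm: p whitened coordinates, each of variance 1 /
    n0, add up to p / n0, which tends to J0. *)
Lemma cvg_bilS_xb00 (l : R) : (fun p => bilS (S p) (mu0 p) (mu0 p)) @ \oo --> l ->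
  onF (fun p w => bilS (S p) (xb0 w) (xb0 w)) @ F --> l + J0.
Proof.
move=> ul; have uc : cvgn (fun p => bilS (S p) (mu0 p) (mu0 p)) by apply/cvg_ex; exists l.
rewrite (_ : onF _ = fun z : {p & Om p} =>
   bilS (S (projT1 z)) (mu0 (projT1 z)) (mu0 (projT1 z))
   + 2 * onF (fun p w => bilS (S p) (mu0 p) (dev 1 0 w)) z
   + onF (fun p w => bilS (S p) (dev 1 0 w) (dev 1 0 w)) z); last first.
  apply/funext => -[p w]; rewrite /onF /=; rewrite dev10; move: (dev 1 0 w) => v.
  by rewrite bilSDr !bilSDl (bilSC (spdS p) v (mu0 p)); ring.
rewrite (_ : l + J0 = l + 2 * 0 + (1 ^+ 2 * J0 + 0 ^+ 2 * J1)); last by ring.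
apply: cvgD; last exact: cvg_bilS_dev.
apply: cvgD; first exact: (cvg_prob_seq P ul).
by apply: cvgM; [exact: cvg_cst | exact: cvg_bilS_cst_dev].
Qed.

Lemma cvg_bilS_xb11 (l : R) : (fun p => bilS (S p) (mu1 p) (mu1 p)) @ \oo --> l ->
  onF (fun p w => bilS (S p) (xb1 w) (xb1 w)) @ F --> l + J1.
Proof.
move=> ul; have uc : cvgn (fun p => bilS (S p) (mu1 p) (mu1 p)) by apply/cvg_ex; exists l.
rewrite (_ : onF _ = fun z : {p & Om p} =>
   bilS (S (projT1 z)) (mu1 (projT1 z)) (mu1 (projT1 z))
   + 2 * onF (fun p w => bilS (S p) (mu1 p) (dev 0 1 w)) z
   + onF (fun p w => bilS (S p) (dev 0 1 w) (dev 0 1 w)) z); last first.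
  apply/funext => -[p w]; rewrite /onF /=; rewrite dev01; move: (dev 0 1 w) => v.
  by rewrite bilSDr !bilSDl (bilSC (spdS p) v (mu1 p)); ring.
rewrite (_ : l + J1 = l + 2 * 0 + (0 ^+ 2 * J0 + 1 ^+ 2 * J1)); last by ring.
apply: cvgD; last exact: cvg_bilS_dev.
apply: cvgD; first exact: (cvg_prob_seq P ul).
by apply: cvgM; [exact: cvg_cst | exact: cvg_bilS_cst_dev].
Qed.

(* The cross term of the two deviations is read off, by polarization, from the
   quadratic form of their difference. *)
Lemma cvg_bilS_xb01 (l : R) :
  cvgn (fun p => bilS (S p) (mu0 p) (mu0 p)) -> cvgn (fun p => bilS (S p) (mu1 p) (mu1 p)) ->
  (fun p => bilS (S p) (mu0 p) (mu1 p)) @ \oo --> l ->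
  onF (fun p w => bilS (S p) (xb0 w) (xb1 w)) @ F --> l.
Proof.
move=> u0 u1 ul.
rewrite (_ : onF _ = fun z : {p & Om p} =>
   bilS (S (projT1 z)) (mu0 (projT1 z)) (mu1 (projT1 z))
   + onF (fun p w => bilS (S p) (mu0 p) (dev 0 1 w)) z
   + onF (fun p w => bilS (S p) (mu1 p) (dev 1 0 w)) z
   + 2^-1 * (onF (fun p w => bilS (S p) (dev 1 0 w) (dev 1 0 w)) z
     + onF (fun p w => bilS (S p) (dev 0 1 w) (dev 0 1 w)) z
     - onF (fun p w => bilS (S p) (dev 1 (-1) w) (dev 1 (-1) w)) z)); last first.
  apply/funext => -[p w]; rewrite /onF /=.
  have -> : dev 1 (-1) w = dev 1 0 w - dev 0 1 w.
    by rewrite /dev !scale1r !scale0r addr0 add0r scaleN1r.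
  rewrite dev10 dev01; move: (dev 1 0 w) (dev 0 1 w) => v0 v1.
  rewrite !bilSBr !bilSBl !bilSDr !bilSDl.
  by rewrite (bilSC (spdS p) v1 v0) (bilSC (spdS p) v0 (mu1 p)); field.
(* The two separate norms and the norm of the difference have the same limit J0 + J1, so the cross
   term vanishes. *)
rewrite (_ : l = l + 0 + 0 + 2^-1 * ((1 ^+ 2 * J0 + 0 ^+ 2 * J1) +
   (0 ^+ 2 * J0 + 1 ^+ 2 * J1) - (1 ^+ 2 * J0 + (-1) ^+ 2 * J1))); last by field.
apply: cvgD.
  apply: cvgD; last exact: cvg_bilS_cst_dev.
  apply: cvgD; last exact: cvg_bilS_cst_dev.
  exact: (cvg_prob_seq P ul).
apply: cvgM; first exact: cvg_cst.
apply: cvgB; last exact: cvg_bilS_dev.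
by apply: cvgD; exact: cvg_bilS_dev.
Qed.

(** [B] and [delta2] are the limits of the discriminant and of the squared estimated distance, kept
    in terms of limits of inner products; their agreement with the stated constants is a separate
    algebraic check. *)
Lemma cvg_epsB (alpha0 : R) (i : bool) (u00 u01 u11 h0 h1 : R) :
  let c := ln ((1 - alpha0) / alpha0) in
  let g := if i then g1 else g0 in
  let m := if i then m1 else m0 in
  let delta2 := u00 + J0 - 2 * u01 + (u11 + J1) in
  let B := (1 + g)^-1 * (if i then u01 - (u11 + J1) else u00 + J0 - u01) +
    g / (1 + g) * (h0 - h1) - 2^-1 * (u00 + J0 - (u11 + J1)) in
  (fun p => bilS (S p) (mu0 p) (mu0 p)) @ \oo --> u00 ->
  (fun p => bilS (S p) (mu0 p) (mu1 p)) @ \oo --> u01 ->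
  (fun p => bilS (S p) (mu1 p) (mu1 p)) @ \oo --> u11 ->
  cvgn (fun p => bilS (S p) (m p) (m p)) ->
  (fun p => bilS (S p) (m p) (mu0 p)) @ \oo --> h0 ->
  (fun p => bilS (S p) (m p) (mu1 p)) @ \oo --> h1 ->
  0 < delta2 ->
  onF (fun p w => epsB (S p) alpha0 (n0 p) (n1 p) (nu0 p) (nu1 p) (m0 p) (m1 p)
    (xb0 w) (xb1 w) i) @ F --> Phi ((-1) ^+ i * ((- B + c) / Num.sqrt delta2)).
Proof.
move=> c g m delta2 B cu00 cu01 cu11 cmm ch0 ch1 d0.
have u0 : cvgn (fun p => bilS (S p) (mu0 p) (mu0 p)) by apply/cvg_ex; exists u00.
have u1 : cvgn (fun p => bilS (S p) (mu1 p) (mu1 p)) by apply/cvg_ex; exists u11.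
have x00 := cvg_bilS_xb00 cu00.
have x11 := cvg_bilS_xb11 cu11.
have x01 := cvg_bilS_xb01 u0 u1 cu01.
have y0 := cvg_bilS_xb0 cmm ch0.
have y1 := cvg_bilS_xb1 cmm ch1.
pose n := if i then n1 else n0; pose nu := if i then nu1 else nu0.
have ny : (fun p => (n p)%:R : R) @ \oo --> +oo by rewrite /n; case: (i).
have nup p : 0 < nu p by rewrite /nu; case: (i); have [] := nu_gt0 p.
have ng : (fun p => nu p / (n p)%:R) @ \oo --> g by rewrite /nu /n /g; case: (i).
have wn : _ @ F --> _ := cvg_prob_seq P (cvg_sample_weight ny nup ng).
have wnu : _ @ F --> _ := cvg_prob_seq P (cvg_prior_weight ny nup ng).
have ws : _ @ F --> _ := cvg_prob_seq P (cvg_shrinkage ny nup).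
(* The estimator becomes an explicit expression in random inner products and deterministic weights,
   each with a known limit along [F]. *)
rewrite (_ : onF _ = fun z : {p & Om p} => Phi ((-1) ^+ i *
  ((- ((n (projT1 z))%:R / ((n (projT1 z))%:R + nu (projT1 z)) *
     (if i then onF (fun p w => bilS (S p) (xb0 w) (xb1 w)) z
                - onF (fun p w => bilS (S p) (xb1 w) (xb1 w)) z
      else onF (fun p w => bilS (S p) (xb0 w) (xb0 w)) z
           - onF (fun p w => bilS (S p) (xb0 w) (xb1 w)) z) +
     nu (projT1 z) / ((n (projT1 z))%:R + nu (projT1 z)) *
       (onF (fun p w => bilS (S p) (m p) (xb0 w)) z
        - onF (fun p w => bilS (S p) (m p) (xb1 w)) z) -
     2^-1 * (onF (fun p w => bilS (S p) (xb0 w) (xb0 w)) z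
             - onF (fun p w => bilS (S p) (xb1 w) (xb1 w)) z)) + c) /
   Num.sqrt (onF (fun p w => bilS (S p) (xb0 w) (xb0 w)) z
     - 2 * onF (fun p w => bilS (S p) (xb0 w) (xb1 w)) z
     + onF (fun p w => bilS (S p) (xb1 w) (xb1 w)) z) *
   Num.sqrt (((n (projT1 z))%:R + nu (projT1 z)) / ((n (projT1 z))%:R + nu (projT1 z) + 1))))); last first.
  apply/funext => -[p w]; rewrite /onF /=.
  move: (xb0 w) (xb1 w) => v0 v1.
  rewrite /epsB (bilS_discriminant (spdS p)) -/(etaS (S p) v0 v1) (etaSE (spdS p)).
  rewrite /n /nu /m; case: (i) => //.
  by rewrite (bilSC (spdS p) v1 v0).
have ci : (fun z => if i then onF (fun p w => bilS (S p) (xb0 w) (xb1 w)) z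
                - onF (fun p w => bilS (S p) (xb1 w) (xb1 w)) z
      else onF (fun p w => bilS (S p) (xb0 w) (xb0 w)) z
           - onF (fun p w => bilS (S p) (xb0 w) (xb1 w)) z) @ F -->
    (if i then u01 - (u11 + J1) else u00 + J0 - u01).
  by case: (i); exact: cvgB.
have cst (a : R) : (fun _ : {p & Om p} => a) @ F --> a by exact: cvg_cst.
apply: cvg_Phi_ratio => //.
  apply: cvgD => //; apply: cvgN; apply: cvgB.
    by apply: cvgD; apply: cvgM => //; exact: cvgB.
  by apply: cvgM => //; exact: cvgB.
by apply: cvgD => //; apply: cvgB => //; exact: cvgM.
Qed.

Lemma measurable_epsB_sample alpha0 i p :
  measurable_fun setT (fun w : Om p => epsB (S p) alpha0 (n0 p) (n1 p) (nu0 p) (nu1 p)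
    (m0 p) (m1 p) (xb0 w) (xb1 w) i).
Proof. exact: (measurable_epsB _ _ _ _ _ _ _ _ _ (@mxb0 p) (@mxb1 p)). Qed.

End Asymptotics.

(** * Limits of the conditional second moments *)

Unset Implicit Arguments.
Set Strict Implicit.
Set Printing Implicit Defensive.

Theorem theorem3 (R : realType) (alpha0 : R)
  (d : nat -> measure_display) (Om : forall p, measurableType (d p))
  (P : forall p, probability (Om p) R)
  (S : forall p, 'M[R]_p) (mu0 mu1 m0 m1 : forall p, 'cV[R]_p)
  (n0 n1 : nat -> nat) (nu0 nu1 : nat -> R)
  (X0 X1 : forall p, nat -> Om p -> 'cV[R]_p)
  (J0 J1 g0 g1 : R) :
  0 < alpha0 < 1 ->
  (forall p, spd (S p)) ->
  (forall p, 0 < nu0 p /\ 0 < nu1 p) ->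
  (* the sample: n0 i.i.d. N(mu0, S) points and n1 i.i.d. N(mu1, S) points,
     all mutually independent *)
  (forall p k, (k < n0 p)%N -> gaussian_vec (P p) (X0 p k) (mu0 p) (S p)) ->
  (forall p k, (k < n1 p)%N -> gaussian_vec (P p) (X1 p k) (mu1 p) (S p)) ->
  (forall p, mutually_independent (P p)
      (fun ik : bool * nat => (ik.2 < (if ik.1 then n1 p else n0 p))%N)
      (fun ik : bool * nat => if ik.1 then X1 p ik.2 else X0 p ik.2)) ->
  (* the conditional asymptotic regime *)
  (fun p => (n0 p)%:R : R) @ \oo --> +oo ->
  (fun p => (n1 p)%:R : R) @ \oo --> +oo ->
  nu0 @ \oo --> +oo ->
  nu1 @ \oo --> +oo ->
  (fun p => p%:R / (n0 p)%:R : R) @ \oo --> J0 ->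
  (fun p => p%:R / (n1 p)%:R : R) @ \oo --> J1 ->
  (fun p => nu0 p / (n0 p)%:R) @ \oo --> g0 ->
  (fun p => nu1 p / (n1 p)%:R) @ \oo --> g1 ->
  (forall F G : forall p, 'cV[R]_p,
     (F = m0 \/ F = m1 \/ F = mu0 \/ F = mu1) ->
     (G = m0 \/ G = m1 \/ G = mu0 \/ G = mu1) ->
     cvgn (fun p => bilS (S p) (F p) (G p))) ->
  let dbar := limn (fun p => etaS (S p) (mu0 p) (mu1 p)) in
  let D := dbar + J0 + J1 in
  0 < D ->
  let c := ln ((1 - alpha0) / alpha0) in
  let etabar (F G : forall p, 'cV[R]_p) := limn (fun p => etaS (S p) (F p) (G p)) in
  let G0 := (2 * (1 + g0))^-1 *
      (g0 * (etabar m0 mu1 - etabar m0 mu0) + dbar + (1 - g0) * J0 + (1 + g0) * J1) in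
  let G1 := - (2 * (1 + g1))^-1 *
      (g1 * (etabar m1 mu0 - etabar m1 mu1) + dbar + (1 - g1) * J1 + (1 + g1) * J0) in
  let GB (i : bool) := if i then G1 else G0 in
  let eB p (i : bool) (w : Om p) :=
      epsB (S p) alpha0 (n0 p) (n1 p) (nu0 p) (nu1 p) (m0 p) (m1 p)
           (smean (n0 p) (X0 p) w) (smean (n1 p) (X1 p) w) i in
  (forall i j : bool,
     (fun p => (\int[P p]_w (eB p i w * eB p j w)%:E)%E) @ \oo -->
       (Phi ((-1) ^+ i * (- GB i + c) / Num.sqrt D) *
        Phi ((-1) ^+ j * (- GB j + c) / Num.sqrt D))%:E)
  /\
  (fun p => (\int[P p]_w ((alpha0 * eB p false w + (1 - alpha0) * eB p true w) ^+ 2)%:E)%E)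
     @ \oo -->
    ((alpha0 * Phi ((- G0 + c) / Num.sqrt D)
      + (1 - alpha0) * Phi ((G1 - c) / Num.sqrt D)) ^+ 2)%:E.
Proof.
move=> /andP[al0 al1] spdS nup gX0 gX1 indX n0y n1y _ _ pn0 pn1 nun0 nun1 bc dbar D D0 c etabar.
move=> G0 G1 GB eB.
pose Fam F := F = m0 \/ F = m1 \/ F = mu0 \/ F = mu1.
have Fm0 : Fam m0 by left.
have Fm1 : Fam m1 by right; left.
have Fmu0 : Fam mu0 by right; right; left.
have Fmu1 : Fam mu1 by right; right; right.
pose lim_bil F G := limn (fun p => bilS (S p) (F p) (G p)).
have cvg_bil F G : Fam F -> Fam G ->
  (fun p => bilS (S p) (F p) (G p)) @ \oo --> lim_bil F G := bc F G.
(* The constants of the statement are limits of squared distances, whereas the estimator was treated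
   through inner products; this translates between them. *)
have etabarE F G : Fam F -> Fam G ->
    etabar F G = lim_bil F F - 2 * lim_bil F G + lim_bil G G.
  move=> hF hG; apply/cvg_lim => //.
  rewrite (_ : (fun p => _) = fun p => bilS (S p) (F p) (F p)
     - 2 * bilS (S p) (F p) (G p) + bilS (S p) (G p) (G p)); last first.
    by apply/funext => p; exact: etaSE.
  apply: cvgD; last exact: cvg_bil.
  apply: cvgB; first exact: cvg_bil.
  by apply: cvgM; [exact: cvg_cst | exact: cvg_bil].
have DE : D = lim_bil mu0 mu0 + J0 - 2 * lim_bil mu0 mu1 + (lim_bil mu1 mu1 + J1).
  by rewrite /D /dbar -/(etabar mu0 mu1) etabarE//; ring.
have g0_ge0 : 0 <= g0 by apply: (@ratio_limit_ge0 R n0 nu0) => // p; case: (nup p).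
have g1_ge0 : 0 <= g1 by apply: (@ratio_limit_ge0 R n1 nu1) => // p; case: (nup p).
have g0n : 1 + g0 != 0 by rewrite gt_eqF// ltr_pwDl.
have g1n : 1 + g1 != 0 by rewrite gt_eqF// ltr_pwDl.
have lim_bilC F G : lim_bil F G = lim_bil G F.
  by congr (limn _); apply/funext => p; exact: bilSC.
have ceB i : (fun z : {p & Om p} => eB (projT1 z) i (projT2 z)) @ prob_filter P -->
    Phi ((-1) ^+ i * (- GB i + c) / Num.sqrt D).
  pose m := if i then m1 else m0.
  have Fm : Fam m by rewrite /m; case: (i).
  rewrite DE in D0.
  have := @cvg_epsB _ _ _ P S mu0 mu1 m0 m1 n0 n1 nu0 nu1 X0 X1 J0 J1 g0 g1 spdS gX0 gX1 indX
    n0y n1y nup pn0 pn1 nun0 nun1 alpha0 i _ _ _ _ _ (cvg_bil mu0 mu0 Fmu0 Fmu0)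
    (cvg_bil mu0 mu1 Fmu0 Fmu1) (cvg_bil mu1 mu1 Fmu1 Fmu1) (bc m m Fm Fm)
    (cvg_bil m mu0 Fm Fmu0) (cvg_bil m mu1 Fm Fmu1) D0.
  rewrite -DE -/c mulrA.
  set B := (X in - X + c).
  (* In the difference of the two [etabar] terms the squared norm of the prior mean cancels; what
     remains is a rational identity with denominator 2 (1 + g), nonzero since g >= 0. *)
  suff -> : B = GB i by [].
  rewrite /B /GB /G0 /G1 /dbar -/(etabar mu0 mu1) !etabarE// /m.
  by case: (i); rewrite ?(lim_bilC mu1) ?(lim_bilC mu0 m1); field.
have meB i p : measurable_fun setT (eB p i).
  exact: (measurable_epsB_sample m0 m1 nu0 nu1 gX0 gX1 alpha0 i).
have eB01 p i w : 0 <= eB p i w <= 1 by exact: epsB_itv.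
split.
  move=> i j.
  (* Both factors have constant limits in probability, so the expectation of the product tends to
     the product of these constants, although the factors share the same sample. *)
  apply: (@cvg_mean R d Om P (fun z => eB (projT1 z) i (projT2 z) * eB (projT1 z) j (projT2 z))).
  - by move=> p; apply: measurable_funM; exact: meB.
  - move=> z; have /andP[a0 a1] := eB01 (projT1 z) i (projT2 z).
    have /andP[b0 b1] := eB01 (projT1 z) j (projT2 z).
    by rewrite mulr_ge0//= mulr_ile1.
  - by apply: cvgM; exact: ceB.
have := ceB false; have := ceB true.
rewrite expr0 expr1 mul1r mulN1r opprD opprK /GB => c1 c0.
apply: (@cvg_mean R d Om P (fun z => (alpha0 * eB (projT1 z) false (projT2 z) +
   (1 - alpha0) * eB (projT1 z) true (projT2 z)) ^+ 2)).
- move=> p; apply: measurable_funX; apply: measurable_funD;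
    by apply: measurable_funM => //; exact: meB.
- move=> z; have /andP[a0 a1] := eB01 (projT1 z) false (projT2 z).
  have /andP[b0 b1] := eB01 (projT1 z) true (projT2 z).
  (* A convex combination of values in [0, 1] stays in [0, 1], and so does its square. *)
  rewrite sqr_ge0/= -[leRHS](expr1n _ 2) lerXn2r ?nnegrE//; nra.
- have h : (fun z : {p & Om p} => alpha0 * eB (projT1 z) false (projT2 z) +
     (1 - alpha0) * eB (projT1 z) true (projT2 z)) @ prob_filter P -->
     alpha0 * Phi ((- G0 + c) / Num.sqrt D) + (1 - alpha0) * Phi ((G1 - c) / Num.sqrt D).
    by apply: cvgD; apply: cvgM => //; exact: cvg_cst.
  exact: (cvgM h h).
Qed.
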